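(* Consider the problem $\min\{p(x)+f(x)+q(y)+g(y) : \mathcal A^*x+\mathcal B^*y=c\}$ and the algorithm MGADMM described in the context, with penalty parameter $\sigma>0$ and relaxation factor $\rho\in(0,2)$. Let $\{(x^k,y^k,z^k)\}_{k\ge 0}$ be the sequence generated by MGADMM and let $(\bar x,\bar y,\bar z)\in\mathcal W^*$ (the set of KKT points). Let $\phi_k,\zeta_k,\vartheta_k,\mathcal M_f,\mathcal N_g$ be as defined in the context. Then the following hold. **(I)** For any $\rho\in(0,2)$, any $\beta\in(0,1/2)$, and with $\mu:=\frac{\beta(1-\beta)}{1-2\beta}$, for every $k\ge 0$: $$\begin{aligned} &\Big(\phi_k(\bar x,\bar y,\bar z)+\sigma\mu(2-\rho)\|\mathcal A^*x^k+\mathcal B^*y^k-c\|^2\Big)-\Big(\phi_{k+1}(\bar x,\bar y,\bar z)+\sigma\mu(2-\rho)\|\mathcal A^*x^{k+1}+\mathcal B^*y^{k+1}-c\|^2\Big)\\ &\ge \Big(\tfrac{1}{\sigma\rho^2}\|z^{k+1}-z^k+\sigma(\rho-1)\mathcal B^*(y^{k+1}-y^k)\|^2+\|x^{k+1}-x^k\|^2_{\widehat\Sigma_f+\mathcal S+\sigma\beta(2-\rho)\mathcal A\mathcal A^*}+\|y^{k+1}-y^k\|^2_{\widehat\Sigma_g+\mathcal T+\sigma\beta(2-\rho)\mathcal B\mathcal B^*}\Big)\\ &\quad-\Big(\tfrac{1+2\mu-\mu\rho}{\sigma\rho^2}\|z^{k+1}-z^k+\sigma(\rho-1)\mathcal B^*(y^{k+1}-y^k)\|^2+\|x^{k+1}-x^k\|^2_{\widehat\Sigma_f-\frac12\Sigma_f}+\|y^{k+1}-y^k\|^2_{\widehat\Sigma_g-\frac12\Sigma_g+\sigma\beta(2-\rho)\mathcal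 B\mathcal B^*}\Big). \end{aligned}$$ Moreover, assume that for some $\rho\in(0,2)$ (the relaxation factor used in the algorithm) and some $\beta\in(0,1/2)$, $$\widehat\Sigma_f+\mathcal S+\sigma\beta(2-\rho)\mathcal A\mathcal A^*\succ0\quad\text{and}\quad \widehat\Sigma_g+\mathcal T+\sigma\beta(2-\rho)\mathcal B\mathcal B^*\succ0,$$ and that $$\sum_{k=0}^\infty\Big(\|x^{k+1}-x^k\|^2_{\widehat\Sigma_f}+\|y^{k+1}-y^k\|^2_{\widehat\Sigma_g+\sigma(2-\rho)\mathcal B\mathcal B^*}+\|\mathcal A^*x^{k+1}+\mathcal B^*y^{k+1}-c\|^2\Big)<+\infty.$$ Then $\{(x^k,y^k)\}$ converges to an optimal solution of the problem and $\{z^k\}$ converges to an optimal solution of the dual problem $$\min_{z\in\mathcal Z}\ \langle c,z\rangle+(p+f)^*(-\mathcal A z)+(q+g)^*(-\mathcal B z),$$ where $(p+f)^*$ and $(q+g)^*$ denote Fenchel conjugates. **(II)** Assume that $\frac12\widehat\Sigma_g+\mathcal T\succeq0$. Then for any $\rho\in(0,2)$, any $\lambda\in(0,1]$ and every $k\ge1$: $$\begin{aligned} &\Big(\phi_k(\bar x,\bar y,\bar z)+\sigma(1-\lambda)(2-\rho)\|\mathcal A^*x^k+\mathcal B^*y^k-c\|^2+\tfrac{\lambda(2-\rho)}{\rho}\zeta_k\Big)\\ &\quad-\Big(\phi_{k+1}(\bar x,\bar y,\bar z)+\sigma(1-\lambda)(2-\rho)\|\mathcal A^*x^{k+1}+\mathcal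 B^*y^{k+1}-c\|^2+\tfrac{\lambda(2-\rho)}{\rho}\zeta_{k+1}\Big)\\ &\ge\ \vartheta_{k+1}+\sigma(2\lambda-1)(2-\rho)\|\mathcal A^*x^{k+1}+\mathcal B^*y^{k+1}-c\|^2 . \end{aligned}$$ Moreover, assume in addition that for some $\rho\in(0,2)$ (the relaxation factor used in the algorithm) and some $\lambda\in(\frac12,1]$, $$\widehat\Sigma_f+\mathcal S\succeq0,\qquad \mathcal M_f\succeq0,\qquad \mathcal N_g\succ0,$$ $$\tfrac12\Sigma_f+\mathcal S+\sigma(2-\rho)\mathcal A\mathcal A^*\succ0\quad\text{and}\quad\tfrac12\Sigma_g+\mathcal T+\sigma(2-\rho)\mathcal B\mathcal B^*\succ0.$$ Then $\{(x^k,y^k)\}$ converges to an optimal solution of the problem and $\{z^k\}$ converges to an optimal solution of the dual problem displayed in (I).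
   Context: **Problem.** $\mathcal X=\mathcal X_1\times\cdots\times\mathcal X_s$, $\mathcal Y=\mathcal Y_1\times\cdots\times\mathcal Y_t$ and $\mathcal Z$ are real finite-dimensional Euclidean spaces with inner products $\langle\cdot,\cdot\rangle$ and induced norms $\|\cdot\|$. $p(x)=p_1(x_1)$ and $q(y)=q_1(y_1)$, where $p_1:\mathcal X_1\to(-\infty,+\infty]$ and $q_1:\mathcal Y_1\to(-\infty,+\infty]$ are closed proper convex functions. $f:\mathcal X\to\mathbb R$ and $g:\mathcal Y\to\mathbb R$ are convex, differentiable, with globally Lipschitz continuous gradients. $\mathcal A:\mathcal Z\to\mathcal X$, $\mathcal B:\mathcal Z\to\mathcal Y$ are linear with adjoints $\mathcal A^*,\mathcal B^*$, and $c\in\mathcal Z$. The problem is $\min_{x\in\mathcal X,y\in\mathcal Y}\{p(x)+f(x)+q(y)+g(y) : \mathcal A^*x+\mathcal B^*y=c\}$. Standing assumption: there is $(x,y)\in \mathrm{ri}(\mathrm{dom}\,p\times\mathrm{dom}\,q)$ with $\mathcal A^*x+\mathcal B^*y=c$. **Notation.** For a self-adjoint linear operator $\mathcal G$ (not necessarily positive semidefinite), $\|u\|_{\mathcal G}^2:=\langle u,\mathcal Gu\rangle$. $\succeq0$ / $\succ0$ mean self-adjoint positive semidefinite / definite. **Majorization.** $\Sigma_f,\widehat\Sigma_f$ (on $\mathcal X$) and $\Sigma_g,\widehat\Sigma_g$ (on $\mathcal Y$) are fixed self-adjoint positive semidefinite operators such that for all $x,x'\in\mathcal X$, $y,y'\in\mathcal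 Y$: $$f(x')+\langle x-x',\nabla f(x')\rangle+\tfrac12\|x-x'\|^2_{\Sigma_f}\le f(x)\le f(x')+\langle x-x',\nabla f(x')\rangle+\tfrac12\|x-x'\|^2_{\widehat\Sigma_f},$$ $$g(y')+\langle y-y',\nabla g(y')\rangle+\tfrac12\|y-y'\|^2_{\Sigma_g}\le g(y)\le g(y')+\langle y-y',\nabla g(y')\rangle+\tfrac12\|y-y'\|^2_{\widehat\Sigma_g}.$$ **KKT points.** $\mathcal W^*$ is the set of $(\bar x,\bar y,\bar z)\in\mathcal X\times\mathcal Y\times\mathcal Z$ with $0\in\partial p(\bar x)+\nabla f(\bar x)+\mathcal A\bar z$, $0\in\partial q(\bar y)+\nabla g(\bar y)+\mathcal B\bar z$, $\mathcal A^*\bar x+\mathcal B^*\bar y=c$. **Algorithm MGADMM.** Let $\rho\in(0,2)$, $\sigma>0$, and let $\mathcal S:\mathcal X\to\mathcal X$, $\mathcal T:\mathcal Y\to\mathcal Y$ be self-adjoint linear operators (not necessarily positive semidefinite) such that $\mathcal P:=\widehat\Sigma_f+\mathcal S+\sigma\mathcal A\mathcal A^*$ and $\mathcal Q:=\widehat\Sigma_g+\mathcal T+\sigma\mathcal B\mathcal B^*$ are positive definite. Given $(x^0,y^0,z^0)\in\mathrm{dom}(p)\times\mathrm{dom}(q)\times\mathcal Z$, for $k=0,1,2,\dots$: $$\begin{aligned} x^{k+1}&=\arg\min_{x\in\mathcal X}\ p(x)+\tfrac12\langle x,\mathcal Px\rangle+\big\langle\nabla f(x^k)+\sigma\mathcal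 A(\mathcal A^*x^k+\mathcal B^*y^k-c+\sigma^{-1}z^k)-\mathcal Px^k,\,x\big\rangle,\\ y^{k+1}&=\arg\min_{y\in\mathcal Y}\ q(y)+\tfrac12\langle y,\mathcal Qy\rangle+\big\langle\nabla g(y^k)+\sigma\rho\mathcal B(\mathcal A^*x^k+\mathcal B^*y^k-c+(\sigma\rho)^{-1}z^k)+\sigma\rho\mathcal B\mathcal A^*(x^{k+1}-x^k)-\mathcal Qy^k,\,y\big\rangle,\\ z^{k+1}&=z^k+\sigma\big(\rho\mathcal A^*x^{k+1}-(1-\rho)\mathcal B^*y^k+\mathcal B^*y^{k+1}-\rho c\big). \end{aligned}$$ **Quantities.** For $\lambda\in(0,1]$, $$\mathcal M_f:=\tfrac12\Sigma_f+\mathcal S+\tfrac12\sigma(1-\lambda)(2-\rho)\mathcal A\mathcal A^*,\qquad \mathcal N_g:=\tfrac12\Sigma_g+\mathcal T+\sigma\tfrac{\lambda(2-\rho)^2}{\rho}\mathcal B\mathcal B^*.$$ For $(x,y,z)\in\mathcal X\times\mathcal Y\times\mathcal Z$ and $k\ge0$, $$\phi_k(x,y,z):=(\sigma\rho)^{-1}\|z^k-z+\sigma(\rho-1)\mathcal B^*(y^k-y)\|^2+\|x^k-x\|^2_{\widehat\Sigma_f+\mathcal S}+\|y^k-y\|^2_{\widehat\Sigma_g+\mathcal T+\sigma(2-\rho)\mathcal B\mathcal B^*},$$ and for $k\ge1$, $$\vartheta_k:=\|x^k-x^{k-1}\|^2_{\mathcal M_f}+\|y^k-y^{k-1}\|^2_{\mathcal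 N_g},\qquad \zeta_k:=\|y^k-y^{k-1}\|^2_{\widehat\Sigma_g+\mathcal T}.$$ *)

(* Defs.v *)
From HB Require Import structures.
From mathcomp Require Import all_boot all_order all_algebra.
From mathcomp Require Import all_classical all_reals all_analysis.
Import Order.TTheory GRing.Theory Num.Theory.
Import numFieldNormedType.Exports.

Set Implicit Arguments.
Unset Strict Implicit.
Unset Printing Implicit Defensive.

Local Open Scope classical_set_scope.
Local Open Scope ring_scope.

(* Finite-dimensional real inner product spaces, with the norm induced by the
   inner product and the topology of that norm. *)
HB.mixin Record isEuclidean (R : realType) V
    & NormedModule R V & Vector R V := {
  inner : V -> V -> R ;
  innerC : forall u v, inner u v = inner v u ;
  innerP : forall (a : R) u v w, inner (a *: u + v) w = a * inner u w + inner v w ;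
  innerxx : forall u, inner u u = `|u| ^+ 2
}.

#[short(type="euclidType")]
HB.structure Definition Euclidean (R : realType) :=
  {V of isEuclidean R V & NormedModule R V & Vector R V}.

HB.factory Record Vector_hasInner (R : realType) V & Vector R V := {
  inner : V -> V -> R ;
  innerC : forall u v, inner u v = inner v u ;
  innerP : forall (a : R) u v w, inner (a *: u + v) w = a * inner u w + inner v w ;
  inner_gt0 : forall u, u != 0 -> 0 < inner u u
}.

HB.builders Context R V & Vector_hasInner R V.

Let inner0 u : inner 0 u = 0.
Proof. by have := innerP (-1) 0 0 u; rewrite scaler0 add0r mulN1r addNr. Qed.

Let innerD u v w : inner (u + v) w = inner u w + inner v w.
Proof. by rewrite -{1}[u]scale1r innerP mul1r. Qed.

Let innerZ a u w : inner (a *: u) w = a * inner u w.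
Proof. by rewrite -[a *: u]addr0 innerP inner0 addr0. Qed.

Let inner_ge0 u : 0 <= inner u u.
Proof. by have [->|/inner_gt0/ltW//] := eqVneq u 0; rewrite inner0. Qed.

Let norm u := Num.sqrt (inner u u).

Let norm_sq u : norm u ^+ 2 = inner u u.
Proof. exact: sqr_sqrtr. Qed.

Let cauchy_schwarz u v : inner u v <= norm u * norm v.
Proof.
have [->|v0] := eqVneq v 0; first by rewrite innerC inner0 mulr_ge0 ?sqrtr_ge0.
have vv := inner_gt0 v0.
have [uv|uv] := ltP (inner u v) 0.
  by rewrite (le_trans (ltW uv))// mulr_ge0 ?sqrtr_ge0.
rewrite -(@ler_pXn2r _ 2) ?nnegrE ?mulr_ge0 ?sqrtr_ge0//.
rewrite exprMn !norm_sq -(ler_pdivrMr _ _ vv).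
set k := inner u v / inner v v.
have := inner_ge0 (- k *: v + u).
rewrite innerP (innerC v) (innerC u (_ + _)) !innerP (innerC v u).
rewrite [- k * inner v v]mulNr divfK ?gt_eqF// addNr mulr0 add0r mulNr addrC.
by rewrite subr_ge0 /k mulrAC -expr2.
Qed.

Let ler_normD u v : norm (u + v) <= norm u + norm v.
Proof.
rewrite -(@ler_pXn2r _ 2) ?nnegrE ?addr_ge0 ?sqrtr_ge0//.
rewrite sqrrD !norm_sq innerD (innerC u) (innerC v) !innerD (innerC v u).
have := cauchy_schwarz u v.
set a := inner u u; set b := inner u v; set d := inner v v => buv.
have -> : a + b + (b + d) = a + b *+ 2 + d by rewrite mulr2n !addrA.
by rewrite lerD2r lerD2l lerMn2r.
Qed.

Let normrZ a u : norm (a *: u) = `|a| * norm u.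
Proof.
rewrite /norm innerZ innerC innerZ mulrA -expr2 sqrtrM ?sqr_ge0//.
by rewrite sqrtr_sqr.
Qed.

Let normr0_eq0 u : norm u = 0 -> u = 0.
Proof.
move=> u0; apply/eqP/negPn/negP => /inner_gt0.
by rewrite -norm_sq u0 expr0n/= ltxx.
Qed.

HB.instance Definition _ :=
  Lmodule_isNormed.Build R V ler_normD normrZ normr0_eq0.

HB.instance Definition _ :=
  isEuclidean.Build R V innerC innerP (fun u => esym (norm_sq u)).

HB.end.

(* The product E_0 x ... x E_(n-1), with <u, v> = \sum_i <u_i, v_i>. *)
Definition eprod (R : realType) n (E : 'I_n -> euclidType R) : Type :=
  {dffun forall i, E i}.

Section eprod.
Import VectorInternalTheory.
Context (R : realType) n (E : 'I_n -> euclidType R).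
Local Notation T := (eprod E).

HB.instance Definition _ := Choice.on T.

Let zero : T := [ffun i => 0 : E i].
Let opp (u : T) : T := [ffun i => - u i : E i].
Let add (u v : T) : T := [ffun i => u i + v i : E i].
Let scale (a : R) (u : T) : T := [ffun i => a *: u i : E i].

Let addA : associative add.
Proof. by move=> u v w; apply/ffunP => i; rewrite !ffunE addrA. Qed.
Let addC : commutative add.
Proof. by move=> u v; apply/ffunP => i; rewrite !ffunE addrC. Qed.
Let add0 : left_id zero add.
Proof. by move=> u; apply/ffunP => i; rewrite !ffunE add0r. Qed.
Let addN : left_inverse zero opp add.
Proof. by move=> u; apply/ffunP => i; rewrite !ffunE addNr. Qed.

HB.instance Definition _ := GRing.isZmodule.Build T addA addC add0 addN.

Let scaleA a b u : scale a (scale b u) = scale (a * b) u.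
Proof. by apply/ffunP => i; rewrite !ffunE scalerA. Qed.
Let scale1 : left_id 1 scale.
Proof. by move=> u; apply/ffunP => i; rewrite !ffunE scale1r. Qed.
Let scaleDr : right_distributive scale +%R.
Proof. by move=> a u v; apply/ffunP => i; rewrite !ffunE scalerDr. Qed.
Let scaleDl u : {morph scale^~ u : a b / a + b}.
Proof. by move=> a b; apply/ffunP => i; rewrite !ffunE scalerDl. Qed.

HB.instance Definition _ :=
  GRing.Zmodule_isLmodule.Build R T scaleA scale1 scaleDr scaleDl.

Lemma eprodD (u v : T) i : (u + v) i = u i + v i.
Proof. exact: ffunE. Qed.
Lemma eprodZ a (u : T) i : (a *: u) i = a *: u i.
Proof. exact: ffunE. Qed.
Lemma eprod0 i : (0 : T) i = 0.
Proof. exact: ffunE. Qed.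

Let eprod_vect : Vector.axiom (\sum_i dim (E i)) T.
Proof.
exists (fun u : T => \mxrow_i (v2r (u i) : 'rV_(dim (E i)))).
  move=> a u v; apply/mxrowP => i; rewrite submxrowD !mxrowK eprodD eprodZ.
  have subZ w : submxrow (a *: w) i = a *: submxrow w i.
    by apply/matrixP => j l; rewrite !mxE.
  by rewrite subZ mxrowK linearP.
exists (fun w => [ffun i => r2v (submxrow w i) : E i]) => [u|w].
  by apply/ffunP => i; rewrite ffunE mxrowK v2rK.
by apply/mxrowP => i; rewrite mxrowK ffunE r2vK.
Qed.

HB.instance Definition _ := Lmodule_hasFinDim.Build R T eprod_vect.

Let einner (u v : T) : R := \sum_i inner (u i) (v i).

Let einnerC u v : einner u v = einner v u.
Proof. by apply: eq_bigr => i _; exact: innerC. Qed.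

Let einnerP a u v w : einner (a *: u + v) w = a * einner u w + einner v w.
Proof.
rewrite mulr_sumr -big_split; apply: eq_bigr => i _.
by rewrite eprodD eprodZ innerP.
Qed.

Let einner_gt0 u : u != 0 -> 0 < einner u u.
Proof.
move=> u0; have uge i : 0 <= inner (u i) (u i) by rewrite innerxx sqr_ge0.
rewrite lt_neqAle sumr_ge0// andbT eq_sym; apply: contra u0.
rewrite psumr_eq0// => /allP u0; apply/eqP/ffunP => i.
apply/eqP; have := u0 i (mem_index_enum i).
by rewrite /= innerxx sqrf_eq0 normr_eq0 eprod0.
Qed.

HB.instance Definition _ :=
  Vector_hasInner.Build R T einnerC einnerP einner_gt0.

End eprod.

Section operators.
Context (R : realType) (V W : euclidType R).
Implicit Type G : V -> V.

Definition adjoint (A : V -> W) (As : W -> V) :=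
  forall v w, inner (A v) w = inner v (As w).

Definition selfadjoint G := forall u v, inner (G u) v = inner u (G v).

Definition psd G := selfadjoint G /\ forall u, 0 <= inner u (G u).

Definition pd G := selfadjoint G /\ forall u, u != 0 -> 0 < inner u (G u).

(* |u|_G^2; may be negative when G is not positive semidefinite. *)
Definition sqnorm G u : R := inner u (G u).

(* df is the (Riesz) gradient of the Frechet differentiable function f. *)
Definition is_gradient (f : V -> R) (df : V -> V) :=
  forall x, differentiable f x /\ ('d f x : V -> R) = inner (df x).

End operators.

Section convex_analysis.
Local Open Scope ereal_scope.
Context (R : realType).

Definition affine_set (V : lmodType R) (C : set V) :=
  forall (a : R) u v, C u -> C v -> C (a *: u + (1 - a) *: v)%R.

Definition affine_hull (V : lmodType R) (C : set V) : set V :=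
  smallest (@affine_set V) C.

Definition relint (V : normedModType R) (C : set V) : set V :=
  [set u | affine_hull C u /\
           exists2 U, nbhs u U & U `&` affine_hull C `<=` C].

Definition edom T (h : T -> \bar R) : set T := [set u | h u < +oo].

Definition proper T (h : T -> \bar R) := edom h !=set0 /\ forall u, -oo < h u.

(* a ranges over the open interval only, so that no 0 * +oo occurs; the sums
   are never of the form +oo - oo when h is proper. *)
Definition convex_efun (V : lmodType R) (h : V -> \bar R) :=
  forall (a : R) u v, (0 < a < 1)%R ->
    h (a *: u + (1 - a) *: v)%R <= a%:E * h u + (1 - a)%:E * h v.

(* A proper convex function is closed iff it is lower semicontinuous. *)
Definition closed_proper_convex (V : normedModType R) (h : V -> \bar R) :=
  [/\ lower_semicontinuous h, proper h & convex_efun h].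

Definition subdifferential (V : euclidType R) (h : V -> \bar R) (u : V) : set V :=
  [set g | forall v, h u + (inner g (v - u)%R)%:E <= h v].

Definition conjugate (V : euclidType R) (h : V -> \bar R) (g : V) : \bar R :=
  ereal_sup [set (inner g u)%:E - h u | u in [set: V]].

(* Minimizers are required to have a value < +oo, so the set is empty when
   h = +oo on D. *)
Definition argmin T (D : set T) (h : T -> \bar R) : set T :=
  [set u | [/\ D u, h u < +oo & forall v, D v -> h u <= h v]].

End convex_analysis.

Section problem.
Context (R : realType) (X Y Z : euclidType R).
Variables (p : X -> \bar R) (q : Y -> \bar R) (f : X -> R) (g : Y -> R).
Variables (df : X -> X) (dg : Y -> Y).
Variables (A : Z -> X) (As : X -> Z) (B : Z -> Y) (Bs : Y -> Z) (c : Z).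

Definition feasible : set (X * Y) := [set w | As w.1 + Bs w.2 = c].

Definition primal_obj (w : X * Y) : \bar R :=
  (p w.1 + (f w.1)%:E + (q w.2 + (g w.2)%:E))%E.

Definition primal_solutions : set (X * Y) := argmin feasible primal_obj.

Definition dual_obj (z : Z) : \bar R :=
  ((inner c z)%:E + conjugate (fun u => p u + (f u)%:E) (- A z)%R
                  + conjugate (fun v => q v + (g v)%:E) (- B z)%R)%E.

Definition dual_solutions : set Z := argmin setT dual_obj.

Definition kkt : set (X * Y * Z) :=
  [set w | let: (x, y, z) := w in
    [/\ exists2 u, subdifferential p x u & u + df x + A z = 0,
        exists2 v, subdifferential q y v & v + dg y + B z = 0
      & As x + Bs y = c]].

Section mgadmm.
Variables (rho sigma : R) (P : X -> X) (Q : Y -> Y).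
Variables (x : nat -> X) (y : nat -> Y) (z : nat -> Z).

(* P = Sfh + S + sigma A A^* and Q = Sgh + T + sigma B B^*, with Sfh, Sgh the
   majorization operators and S, T the proximal ones. The iterates are only
   required to be minimizers; they are unique when P and Q are definite. *)
Definition mgadmm :=
  [/\ edom p (x 0%N), edom q (y 0%N) &
   forall k,
   [/\ argmin setT (fun u => p u + (2^-1 * inner u (P u) +
         inner (df (x k)
                + sigma *: A (As (x k) + Bs (y k) - c + sigma^-1 *: z k)
                - P (x k)) u)%R%:E)%E
         (x k.+1),
       argmin setT (fun v => q v + (2^-1 * inner v (Q v) +
         inner (dg (y k)
                + (sigma * rho) *:
                    B (As (x k) + Bs (y k) - c + (sigma * rho)^-1 *: z k)
                + (sigma * rho) *: B (As (x k.+1 - x k))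
                - Q (y k)) v)%R%:E)%E
         (y k.+1)
     & z k.+1 = z k + sigma *: (rho *: As (x k.+1) - (1 - rho) *: Bs (y k)
                                + Bs (y k.+1) - rho *: c)]].

End mgadmm.
End problem.

(* Main.v *)
Require Import Defs.
From HB Require Import structures.
From mathcomp Require Import all_boot all_order all_algebra.
From mathcomp Require Import all_classical all_reals all_analysis.
From mathcomp Require Import ring lra.
Import Order.TTheory GRing.Theory Num.Theory.
Import numFieldNormedType.Exports.

Set Implicit Arguments.
Unset Strict Implicit.
Unset Printing Implicit Defensive.

Local Open Scope classical_set_scope.
Local Open Scope ring_scope.

(* Each subproblem yields a subgradient of p or q at the new iterate. Monotonicity
   of the subdifferentials against a KKT point, a three-point inequality for the
   gradients coming from the two-sided majorization, and an exact identity for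
   the relaxed multiplier step, where z^{k+1} - z^k + sigma (rho - 1) B^* dy equals
   sigma rho times the new residual, give the basic descent
     phi_k - phi_{k+1} >= |dx|^2_{Sf/2 + S} + |dy|^2_{Sg/2 + T}
                          + sigma (2 - rho) |A^* x^{k+1} + B^* y^k - c|^2.
   Both inequalities follow by splitting the last term differently: (I) by a
   perfect square in the residual and A^* dx, (II) with the help of the
   monotonicity of the subdifferential of q at two consecutive iterates.

   For the convergence the left-hand potential is quasi-decreasing and coercive,
   up to the vanishing residual, at every KKT point. So the iterates are bounded
   and the increments vanish; a cluster point is a KKT point since
   subdifferentials are closed; its own potential converges and vanishes along a
   subsequence, hence tends to 0. KKT points are primal and dual optimal by weak
   duality. *)

(** * Bilinearity of the inner product and the Cauchy-Schwarz inequality *)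

Section inner_theory.
Context (R : realType) (V : euclidType R).
Implicit Types (u v w : V) (a : R).

Lemma inner0l u : inner 0 u = 0.
Proof. by have := innerP (-1) 0 0 u; rewrite scaler0 add0r mulN1r addNr. Qed.

Lemma innerDl u v w : inner (u + v) w = inner u w + inner v w.
Proof. by rewrite -{1}[u]scale1r innerP mul1r. Qed.

Lemma innerZl a u w : inner (a *: u) w = a * inner u w.
Proof. by rewrite -[a *: u]addr0 innerP inner0l addr0. Qed.

Lemma innerNl u w : inner (- u) w = - inner u w.
Proof. by rewrite -scaleN1r innerZl mulN1r. Qed.

Lemma inner0r u : inner u 0 = 0.
Proof. by rewrite innerC inner0l. Qed.

Lemma innerDr u v w : inner w (u + v) = inner w u + inner w v.
Proof. by rewrite innerC innerDl !(innerC w). Qed.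

Lemma innerZr a u w : inner w (a *: u) = a * inner w u.
Proof. by rewrite innerC innerZl (innerC w). Qed.

Lemma innerNr u w : inner w (- u) = - inner w u.
Proof. by rewrite innerC innerNl (innerC w). Qed.

Definition innerE := (innerDl, innerDr, innerNl, innerNr, innerZl, innerZr).

Lemma inner_ge0 u : 0 <= inner u u.
Proof. by rewrite innerxx sqr_ge0. Qed.

Lemma inner_gt0 u : u != 0 -> 0 < inner u u.
Proof. by move=> u0; rewrite innerxx exprn_gt0// normr_gt0. Qed.

(* Expanding [0 <= |(|v|) u - (|u|) v|^2]. *)
Lemma cauchy_schwarz u v : `|inner u v| <= `|u| * `|v|.
Proof.
have CS (u1 v1 : V) : inner u1 v1 <= `|u1| * `|v1|.
  have [->|u0] := eqVneq u1 0; first by rewrite inner0l normr0 mul0r.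
  have [->|v0] := eqVneq v1 0; first by rewrite inner0r normr0 mulr0.
  have := inner_ge0 (`|v1| *: u1 - `|u1| *: v1).
  rewrite !innerE !innerxx (innerC v1 u1) => h.
  have h0 : 0 < `|u1| * `|v1| by rewrite mulr_gt0 ?normr_gt0.
  rewrite -(ler_pM2l h0); nra.
rewrite ler_norml CS andbT lerNl -innerNl (le_trans (CS _ _))//.
by rewrite normrN.
Qed.

Lemma normD_sqr_le u v : `|u + v| ^+ 2 <= 2 * `|u| ^+ 2 + 2 * `|v| ^+ 2.
Proof.
have := inner_ge0 (u - v); rewrite -!innerxx !innerE (innerC v u); lra.
Qed.

End inner_theory.

(** * Quadratic forms of combined operators *)

Section sqnorm_theory.
Context (R : realType) (V W : euclidType R).

Lemma sqnormD (G H : V -> V) u : sqnorm (G \+ H) u = sqnorm G u + sqnorm H u.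
Proof. by rewrite /sqnorm/= innerDr. Qed.

Lemma sqnormB (G H : V -> V) u : sqnorm (G \- H) u = sqnorm G u - sqnorm H u.
Proof. by rewrite /sqnorm/= innerDr innerNr. Qed.

Lemma sqnormZ a (G : V -> V) u : sqnorm (a \*: G) u = a * sqnorm G u.
Proof. by rewrite /sqnorm/= innerZr. Qed.

Lemma sqnorm_adj (A : W -> V) (As : V -> W) u :
  adjoint A As -> sqnorm (A \o As) u = `|As u| ^+ 2.
Proof. by move=> adj; rewrite /sqnorm/= innerC adj innerxx. Qed.

Definition sqnormE := (sqnormB, sqnormD, sqnormZ).

End sqnorm_theory.

(** * Finite dimension: continuity, coercivity of definite forms, compactness *)

Section finite_dimension.
Import VectorInternalTheory.
Context (R : realType).
Implicit Types V W : euclidType R.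

(** By polarization the inner product is a combination of squared norms. *)
Lemma cvg_inner V (T : Type) (F : set_system T) {FF : Filter F}
    (u v : T -> V) (a b : V) :
  u @ F --> a -> v @ F --> b ->
  (fun t => inner (u t) (v t)) @ F --> inner a b.
Proof.
have polar (c d : V) :
    inner c d = 2^-1 * (`|c + d| ^+ 2 - `|c| ^+ 2 - `|d| ^+ 2).
  by rewrite -!innerxx !innerE (innerC d c); field.
move=> ua vb; rewrite polar; under eq_fun do rewrite polar.
have sqr (w : T -> V) (d : V) : w @ F --> d ->
    (fun t => `|w t| ^+ 2) @ F --> `|d| ^+ 2.
  by move=> wd; under eq_fun do rewrite expr2; rewrite expr2;
    apply: cvgM; exact: cvg_norm.
apply: cvgMl_tmp; apply: cvgB; [apply: cvgB|]; apply: sqr => //.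
exact: cvgD.
Qed.

Lemma linear_rV_continuous n (W : normedModType R)
  (L : {linear 'rV[R]_n -> W}) : continuous L.
Proof.
have -> : (L : 'rV[R]_n -> W) = fun a => \sum_i a 0 i *: L (delta_mx 0 i).
  apply/funext => a; rewrite {1}[a]row_sum_delta linear_sum.
  by apply: eq_bigr => i _; rewrite linearZ.
move=> a; apply: (@cvg_big _ _ +%R 0 predT _ _ (nbhs a)) => [|i _].
  exact: add_continuous.
by apply: (@cvgZr_tmp _ _ _ (nbhs a)); exact: coord_continuous.
Qed.

Lemma r2v_continuous V : continuous (r2v : 'rV[R]_(dim V) -> V).
Proof.
exact: (@linear_rV_continuous _ V (r2v : {linear 'rV[R]_(dim V) -> V})).
Qed.

(** The form attains a positive minimum on the compact unit sphere, and homogeneity of degree two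
    does the rest. The sphere is taken in the coordinate space, where compactness is available
    before any comparison with the norm of [V]. *)
Lemma pd_coord_coercive V (G : {linear V -> V}) : pd G ->
  exists2 c : R, 0 < c & forall u, c * `|v2r u| ^+ 2 <= sqnorm G u.
Proof.
move=> [_ Gpd].
(* In the zero space the sphere is empty, and any constant serves. *)
have [[u1 u1n0]|all0] := pselect (exists u : V, u != 0); last first.
  exists 1 => // u; have [->|u0] := eqVneq u 0; last by case: all0; exists u.
  by rewrite linear0 normr0 expr0n/= mulr0 /sqnorm inner0l.
pose sphere := [set a : 'rV[R]_(dim V) | `|a| = 1].
have normalize (u : V) : u != 0 -> sphere (`|v2r u|^-1 *: v2r u).
  move=> u0; rewrite /sphere/= normrZ normfV normr_id mulVf// normr_eq0.
  by apply: contra u0 => /eqP h; rewrite -[u]v2rK h linear0.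
have sphere0 : sphere !=set0.
  by exists (`|v2r u1|^-1 *: v2r u1); exact: normalize.
have sphere_compact : compact sphere.
  apply: bounded_closed_compact.
    by exists 1; split => // M M1 a /= a1; rewrite a1 ltW.
  have -> : sphere = (fun a => `|a|) @^-1` [set 1] by [].
  apply: closed_comp; last exact: closed_eq.
  by move=> a _; exact: norm_continuous.
pose Q (a : 'rV[R]_(dim V)) := sqnorm G (r2v a).
have Qcont : continuous Q.
  move=> a; apply: (@cvg_inner V _ (nbhs a)); first exact: r2v_continuous.
  exact: (@linear_rV_continuous _ V (G \o r2v : {linear 'rV[R]_(dim V) -> V})).
have [a0 /set_mem/= a01 a0min] := compact_EVT_min sphere0 sphere_compact
  (continuous_subspaceT Qcont).
have r2v_neq0 : r2v a0 != (0 : V).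
  apply: contraTneq isT => h; have a00 : a0 = 0 by rewrite -[a0]r2vK h linear0.
  by move/eqP: a01; rewrite a00 normr0 eq_sym oner_eq0.
exists (Q a0); first exact: Gpd.
move=> u; have [->|u0] := eqVneq u 0.
  by rewrite linear0 normr0 expr0n/= mulr0 /sqnorm inner0l.
have vn0 : 0 < `|v2r u|.
  rewrite normr_gt0; apply: contra u0 => /eqP h.
  by rewrite -[u]v2rK h linear0.
rewrite -ler_pdivlMr ?exprn_gt0//.
have := a0min _ (mem_set (normalize _ u0)).
rewrite {2}/Q linearZ/= v2rK /sqnorm linearZ/= !innerE mulrA -expr2 mulrC.
by rewrite exprVn.
Qed.

Lemma id_pd V : pd (@idfun V).
Proof. by split=> // u; exact: inner_gt0. Qed.

(** Coercivity of the identity operator compares the coordinate norm with that of the inner product;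
    this carries boundedness and compactness from row vectors over to [V]. *)
Lemma v2r_bounded V : exists2 C : R, 0 < C & forall u : V, `|v2r u| <= C * `|u|.
Proof.
have [c c0 cP] := pd_coord_coercive (id_pd V).
exists (Num.sqrt c^-1); first by rewrite sqrtr_gt0 invr_gt0.
move=> u; rewrite -(@ler_pXn2r _ 2) ?nnegrE ?mulr_ge0 ?sqrtr_ge0//.
rewrite exprMn sqr_sqrtr ?invr_ge0 ?(ltW c0)// ler_pdivlMl//.
by rewrite (le_trans (cP u))// /sqnorm innerxx.
Qed.

Lemma linear_bound V (W : normedModType R) (L : {linear V -> W}) :
  exists2 C : R, 0 < C & forall u : V, `|L u| <= C * `|u|.
Proof.
have [C C0 CP] := v2r_bounded V.
have [K K0 KP] := linear_lipschitz
  (@linear_rV_continuous _ W (L \o r2v : {linear 'rV[R]_(dim V) -> W})).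
exists (K * C); first exact: mulr_gt0.
move=> u; have /= := KP (v2r u); rewrite v2rK => /le_trans; apply.
by rewrite -mulrA ler_pM2l.
Qed.

Lemma linear_continuousE V (W : normedModType R) (L : {linear V -> W}) :
  continuous L.
Proof.
have [C C0 CP] := linear_bound L.
apply: bounded_linear_continuous; apply/linear_boundedP; near=> r => u.
rewrite (le_trans (CP u))// ler_wpM2r//.
Unshelve. all: by end_near. Qed.

Lemma pd_coercive V (G : {linear V -> V}) : pd G ->
  exists2 c : R, 0 < c & forall u, c * `|u| ^+ 2 <= sqnorm G u.
Proof.
move=> Gpd; have [c c0 cP] := pd_coord_coercive Gpd.
have [K K0 KP] := linear_lipschitz (@r2v_continuous V).
exists (c / K ^+ 2); first by rewrite divr_gt0// exprn_gt0.
move=> u; apply: le_trans (cP u); rewrite -mulrA ler_pM2l//.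
rewrite ler_pdivrMl ?exprn_gt0// -exprMn.
rewrite lerXn2r ?nnegrE ?mulr_ge0 ?(ltW K0)//.
by rewrite -{1}[u]v2rK; exact: KP.
Qed.

Lemma sqnorm_bound V (G : {linear V -> V}) :
  exists2 C : R, 0 < C & forall u, sqnorm G u <= C * `|u| ^+ 2.
Proof.
have [C C0 CP] := linear_bound G; exists C => // u.
rewrite /sqnorm (le_trans (ler_norm _))// (le_trans (cauchy_schwarz _ _))//.
by rewrite expr2 mulrCA ler_wpM2l.
Qed.

(** Compactness is applied to the coordinates. The condition [n <= h n] makes [h] tend to infinity,
    so limits persist along it. *)
Lemma bolzano_weierstrass V (u : nat -> V) (M : R) :
  (forall k, `|u k| <= M) ->
  exists w : V, exists2 h : nat -> nat, (forall n, n <= h n)%N &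
    (fun n => u (h n)) @ \oo --> w.
Proof.
move=> uM; have [C C0 CP] := v2r_bounded V.
pose D := [set a : 'rV[R]_(dim V) | `|a| <= C * M].
have Dcompact : compact D.
  apply: bounded_closed_compact.
    exists (C * M); split; first exact: num_real.
    by move=> N N1 a /= /le_trans; apply; exact: ltW.
  have -> : D = (fun a => `|a|) @^-1` [set t | t <= C * M] by [].
  apply: closed_comp; last exact: closed_le.
  by move=> a _; exact: norm_continuous.
have [|a [_ aclus]] := Dcompact ((fun k => v2r (u k)) @ \oo) _.
  by exists 0%N => // k _; rewrite /D/= (le_trans (CP _))// ler_pM2l.
have {}aclus n : exists k, (n <= k)%N /\ `|a - v2r (u k)| < n.+1%:R^-1.
  have n1 : 0 < n.+1%:R^-1 :> R by rewrite invr_gt0.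
  have [|b []] := aclus [set v2r (u k) | k in [set k | (n <= k)%N]]
    (ball a n.+1%:R^-1) _ (nbhsx_ballx _ _ n1).
  - by exists n => // k/= nk; exists k.
  - by move=> [k nk <-]; rewrite -ball_normE/= => ak; exists k.
have [h hP] := choice aclus.
exists (r2v a); exists h => [n|]; first by have [] := hP n.
under eq_fun do rewrite -[u _]v2rK.
apply: continuous_cvg; first exact: r2v_continuous.
apply/cvgrPdist_lt => e e0; near=> n.
have [_ /lt_trans] := hP n; apply.
by near: n; exact: near_infty_natSinv_lt (PosNum e0).
Unshelve. all: by end_near. Qed.

End finite_dimension.

(** * Real sequences: quasi-monotone convergence, subsequences, series *)

Section sequences.
Context (R : realType).

(** Subtracting from [L] the partial sums of [b] gives a nonincreasing sequence bounded below, so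
    [L] converges; then [D k] is squeezed between 0 and [L k - L k.+1 + b k], which tends to 0. *)
Lemma fejer_monotone_cvg (L b D : nat -> R) :
  (forall k, 0 <= L k) -> (forall k, 0 <= b k) -> (forall k, 0 <= D k) ->
  (forall k, L k.+1 + D k <= L k + b k) -> cvgn (series b) ->
  cvgn L /\ D @ \oo --> 0.
Proof.
move=> L0 b0 D0 LD bcvg.
pose u k := L k - series b k.
have bup k : series b k <= limn (series b).
  apply: nondecreasing_cvgn_le => //; apply/nondecreasing_seqP => n.
  by rewrite /series/= big_nat_recr//= lerDl.
have ucvg : cvgn u.
  apply: nonincreasing_is_cvgn.
    apply/nonincreasing_seqP => n; rewrite /u/series/= big_nat_recr//=.
    by have := LD n; have := D0 n; lra.
  exists (- limn (series b)) => _ [n _ <-]; rewrite /u.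
  by have := L0 n; have := bup n; lra.
have Lcvg : cvgn L.
  have -> : L = u \+ series b by apply/funext => k; rewrite /u/= subrK.
  exact: is_cvgD.
split=> //.
apply: (@squeeze_cvgr _ _ _ _ (fun=> 0) (fun k => L k - L k.+1 + b k)).
- by apply: nearW => k; rewrite D0/=; have := LD k; lra.
- exact: cvg_cst.
- rewrite -[0]addr0 -{1}(subrr (limn L)); apply: cvgD; [apply: cvgB => //|].
    by rewrite (cvg_shiftS L).
  exact: cvg_series_cvg_0.
Qed.

Lemma cvg_subseq (T : Type) (F : set_system T) (u : nat -> T) (h : nat -> nat) :
  (forall n, n <= h n)%N -> u @ \oo --> F -> (fun n => u (h n)) @ \oo --> F.
Proof.
move=> hn; apply: (@cvg_comp _ _ _ h u \oo \oo F) => A [N _ NA].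
by exists N => // n /= Nn; apply: NA; exact: leq_trans (hn n).
Qed.

Lemma cvgn_subseq_eq (L : nat -> R) (h : nat -> nat) (l : R) :
  (forall n, n <= h n)%N -> cvgn L -> (fun n => L (h n)) @ \oo --> l ->
  L @ \oo --> l.
Proof.
move=> hn Lcvg Lh; have := cvg_subseq hn Lcvg => Lh'.
by rewrite -(cvg_unique _ Lh' Lh).
Qed.

Lemma nneseries_cvg_series (a : nat -> R) : (forall k, 0 <= a k) ->
  (\sum_(0 <= k <oo) (a k)%:E < +oo)%E -> cvgn (series a).
Proof.
move=> a0 afin; apply: nondecreasing_is_cvgn.
  by apply/nondecreasing_seqP => n; rewrite /series/= big_nat_recr//= lerDl.
exists (fine (\sum_(0 <= k <oo) (a k)%:E)%E) => _ [n _ <-].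
have s0 : (0 <= \sum_(0 <= k <oo) (a k)%:E)%E.
  by apply: nneseries_ge0 => k _ _; rewrite lee_fin.
rewrite -lee_fin fineK ?ge0_fin_numE// /series/= -sumEFin.
by apply: nneseries_lim_ge => k _; rewrite lee_fin.
Qed.

Lemma le0_of_small_multiples (A N : R) :
  (forall t, 0 < t < 1 -> A <= t * N) -> A <= 0.
Proof.
move=> h; rewrite leNgt; apply/negP => A0.
have N1 := normr_ge0 N; have N2 := ler_norm N.
(* The test value [t = A / (2 * (A + |N| + 1))] lies in (0, 1) and gives [t * N < A]. *)
have d0 : 0 < 2 * (A + `|N| + 1) by lra.
have := h (A / (2 * (A + `|N| + 1))).
rewrite divr_gt0//= ltr_pdivrMr// => /(_ ltac:(lra)).
rewrite mulrAC ler_pdivlMr// ler_pM2l//; lra.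
Qed.

End sequences.

(** * Subdifferentials of proper convex functions *)

Section convex_analysis.
Context (R : realType) (V : euclidType R).
Implicit Types (p : V -> \bar R) (u v : V).

(** A subgradient at a point of value [+oo] would force the value [+oo] everywhere. *)
Lemma subdifferential_fin p u s : Defs.proper p -> subdifferential p u s ->
  p u \is a fin_num.
Proof.
move=> [[v pv] pgt] us; rewrite fin_numE gt_eqF//=.
apply/eqP => pu; have := us v; rewrite pu addye// leye_eq => /eqP pvy.
by move: pv; rewrite /edom/= pvy ltxx.
Qed.

Lemma subdifferentialP p u s a v b : p u = a%:E -> p v = b%:E ->
  subdifferential p u s -> a + inner s (v - u) <= b.
Proof. by move=> pu pv /(_ v); rewrite pu pv -EFinD lee_fin. Qed.

Lemma subdifferential_monotone p u v s t : Defs.proper p ->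
  subdifferential p u s -> subdifferential p v t -> 0 <= inner (s - t) (u - v).
Proof.
move=> pp us vt.
have /fineK pu := subdifferential_fin pp us.
have /fineK pv := subdifferential_fin pp vt.
have := subdifferentialP (esym pu) (esym pv) us.
have := subdifferentialP (esym pv) (esym pu) vt.
rewrite -(opprB u v) !innerE; lra.
Qed.

(* Compare [u] with points of the segment [u, v] tending to [u]. *)
Lemma argmin_quadratic p (G : {linear V -> V}) l u :
  Defs.proper p -> convex_efun p -> selfadjoint G ->
  argmin setT (fun v => p v + (2^-1 * inner v (G v) + inner l v)%:E)%E u ->
  subdifferential p u (- (l + G u)).
Proof.
move=> [_ pgt] pconv Gsa [_ ufin umin] v.
have pufin : p u \is a fin_num.
  rewrite fin_numE gt_eqF//=; apply/eqP => pu.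
  by move: ufin; rewrite pu addye// ltxx.
have [pvy|pvn] := eqVneq (p v) +oo%E; first by rewrite pvy leey.
have pvfin : p v \is a fin_num by rewrite fin_numE gt_eqF.
move: pufin pvfin => /fineK pu /fineK pv.
set a := fine (p u) in pu; set b := fine (p v) in pv.
rewrite -pu -pv -EFinD lee_fin.
set d := v - u.
(* Minimality against [u + t *: d], combined with convexity of [p] on the segment, leaves after
   division by [t] only a remainder of order [t]. *)
suff : a - b - inner (l + G u) d <= 0 by rewrite !innerE; lra.
apply: (@le0_of_small_multiples _ _ (2^-1 * inner d (G d))) => t t01.
have /= := pconv t v u t01; rewrite -pu -pv -!EFinM -EFinD.
have -> : t *: v + (1 - t) *: u = u + t *: d.
  by rewrite /d scalerBl scalerBr scale1r addrC -addrA [- _ + _]addrC.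
clearbody d; have := umin (u + t *: d) I; rewrite -pu.
case pw : (p (u + t *: d)) => [w| |]; last first.
- by have := pgt (u + t *: d); rewrite pw.
- by move=> _; rewrite leye_eq.
- have Gut : G (u + t *: d) = G u + t *: G d by rewrite linearD linearZ.
  rewrite -!EFinD !lee_fin Gut !innerE => h1 h2.
  have Gd : inner d (G u) = inner (G u) d by rewrite innerC.
  move: h1; rewrite Gd -(Gsa u d) => h1.
  have t0 : 0 < t by case/andP: t01.
  rewrite -(ler_pM2l t0); lra.
Qed.

(** For a real [a] below [p u'], lower semicontinuity puts [a] below [p (u n)] eventually, so the
    subgradient inequality passes to the limit with [a] in place of [p u']; then [a] is raised to
    [p u']. *)
Lemma subdifferential_closed p (u s : nat -> V) (u' s' : V) :
  lower_semicontinuous p -> Defs.proper p ->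
  (forall n, subdifferential p (u n) (s n)) ->
  u @ \oo --> u' -> s @ \oo --> s' -> subdifferential p u' s'.
Proof.
move=> plsc pp us uu' ss' v.
have [pvy|pvn] := eqVneq (p v) +oo%E; first by rewrite pvy leey.
have pvfin : p v \is a fin_num by rewrite fin_numE pvn andbT gt_eqF//; case: pp.
move: pvfin => /fineK pv; set b := fine (p v) in pv.
have le_b a : (a%:E < p u')%E -> a + inner s' (v - u') <= b.
  move=> /plsc[U Uu' aU].
  have icvg : (fun n => a + inner (s n) (v - u n)) @ \oo -->
      a + inner s' (v - u').
    apply: cvgD; first exact: cvg_cst.
    apply: cvg_inner => //; apply: cvgB => //; exact: cvg_cst.
  apply: (cvgr_to_le icvg); near=> n.
  have /fineK pun := subdifferential_fin pp (us n).
  have := subdifferentialP (esym pun) (esym pv) (us n).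
  have : (a%:E < p (u n))%E by apply: aU; near: n; exact: uu'.
  rewrite -pun lte_fin; lra.
rewrite -pv; case pu' : (p u') => [w| |].
- rewrite -EFinD lee_fin; apply/ler_addgt0Pr => e e0.
  have := le_b (w - e); rewrite pu' lte_fin => /(_ ltac:(lra)); lra.
(* If [p u'] is [+oo], the level [b + 1 - inner s' (v - u')] is admissible and gives
   [b + 1 <= b]. *)
- suff : False by [].
  have := le_b (b + 1 - inner s' (v - u')); rewrite pu' ltry => /(_ isT); lra.
- by rewrite addNye leNye.
Unshelve. all: by end_near. Qed.

Lemma lipschitz_continuous (W : normedModType R) (f : V -> W) :
  lipschitz f -> continuous f.
Proof.
move=> /pinfty_ex_gt0[M M0 fM] u; apply/cvgrPdist_lt => e e0; near=> v.
have /= h := fM (u, v) (conj I I); apply: (le_lt_trans h).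
rewrite mulrC -ltr_pdivlMr//; near: v.
by apply: cvgr_dist_lt; [exact: cvg_id|exact: divr_gt0].
Unshelve. all: by end_near. Qed.

End convex_analysis.

(** * KKT points solve the primal and the dual problem *)

Section kkt_optimality.
Context (R : realType) (X Y Z : euclidType R).
Variables (p : X -> \bar R) (q : Y -> \bar R) (f : X -> R) (g : Y -> R).
Variables (df : X -> X) (dg : Y -> Y).
Variables (A : {linear Z -> X}) (As : {linear X -> Z}).
Variables (B : {linear Z -> Y}) (Bs : {linear Y -> Z}) (c : Z).
Hypothesis p_proper : Defs.proper p.
Hypothesis q_proper : Defs.proper q.
Hypothesis f_sub : forall u u', f u' + inner (u - u') (df u') <= f u.
Hypothesis g_sub : forall v v', g v' + inner (v - v') (dg v') <= g v.
Hypothesis A_adj : adjoint A As.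
Hypothesis B_adj : adjoint B Bs.

Lemma kkt_subgradients x y z : kkt p q df dg A As B Bs c (x, y, z) ->
  [/\ subdifferential p x (- (df x + A z)),
      subdifferential q y (- (dg y + B z)) & As x + Bs y = c].
Proof.
move=> [[s ps sE] [t qt tE] xy]; split=> //.
- by move/eqP: sE; rewrite -addrA addr_eq0 => /eqP <-.
- by move/eqP: tE; rewrite -addrA addr_eq0 => /eqP <-.
Qed.

(** The subgradient inequalities of [p], [f], [q] and [g] add up, and the multiplier terms cancel
    because both points are feasible. *)
Lemma kkt_primal_solution x y z : kkt p q df dg A As B Bs c (x, y, z) ->
  primal_solutions p q f g As Bs c (x, y).
Proof.
move=> /kkt_subgradients[ps qs xy].
have /fineK px := subdifferential_fin p_proper ps.
have /fineK qy := subdifferential_fin q_proper qs.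
have [_ pgt] := p_proper; have [_ qgt] := q_proper.
split=> //; rewrite /primal_obj/= -px -qy -!EFinD; first exact: ltry.
move=> [u v]; rewrite /feasible/= => uv.
case pu : (p u) => [a| |]; last by have := pgt u; rewrite pu.
- case qv : (q v) => [b| |]; last by have := qgt v; rewrite qv.
  + have := subdifferentialP (esym px) pu ps.
    have := subdifferentialP (esym qy) qv qs.
    have := f_sub u x; have := g_sub v y.
    have : inner (A z) (u - x) + inner (B z) (v - y) = 0.
      rewrite A_adj B_adj -innerDr !linearB/= addrACA -opprD uv xy subrr.
      exact: inner0r.
    move: (u - x) (v - y) => d e.
    rewrite -!EFinD lee_fin !innerNl !innerDl (innerC d) (innerC e); lra.
  + by rewrite addye// addey// leey.
- case qv : (q v) => [b| |]; last by have := qgt v; rewrite qv.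
  + by rewrite !addye// leey.
  + by rewrite !addye// leey.
Qed.

(* Both conjugates are attained at the primal point, so the dual value at [z]
   is minus the primal one, which bounds the dual objective from below. *)
Lemma kkt_dual_solution x y z : kkt p q df dg A As B Bs c (x, y, z) ->
  dual_solutions p q f g A B c z.
Proof.
move=> /kkt_subgradients[ps qs xy].
have /fineK px := subdifferential_fin p_proper ps.
have /fineK qy := subdifferential_fin q_proper qs.
set a := fine (p x) in px; set b := fine (q y) in qy.
have conj_lb (V : euclidType R) (h : V -> \bar R) (k : V -> R) u (e : R) w :
    h u = e%:E ->
    ((inner w u - (e + k u))%:E <= conjugate (fun u => h u + (k u)%:E)%E w)%E.
  move=> hu; apply: ereal_sup_ubound; exists u => //.
  by rewrite hu EFinB EFinD.
(* Equality case of Fenchel-Young: adding the gradient [dk u] to the subgradient of [h] makes [- w]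
   a subgradient of [h + k] at [u], where the supremum is then attained. *)
have conj_eq (V : euclidType R) (h : V -> \bar R) (k : V -> R) (dk : V -> V)
    u (e : R) w :
    (forall u u', k u' + inner (u - u') (dk u') <= k u) ->
    h u = e%:E -> Defs.proper h -> subdifferential h u (- (dk u + w)) ->
    conjugate (fun u => h u + (k u)%:E)%E (- w) =
    (inner (- w) u - (e + k u))%:E.
  move=> k_sub hu [_ hgt] hs; apply/eqP; rewrite eq_le conj_lb// andbT.
  apply: ge_ereal_sup => _ [v _ <-].
  case hv : (h v) => [d| |]; last by have := hgt v; rewrite hv.
    have := subdifferentialP hu hv hs; have := k_sub v u.
    rewrite -(EFinD d) -EFinB lee_fin; rewrite (innerC (v - u)) !innerE; lra.
  by rewrite addye// addeNy leNye.
have dualE : dual_obj p q f g A B c z = (- (a + f x) - (b + g y))%:E.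
  rewrite /dual_obj (conj_eq _ p f df x a (A z) f_sub (esym px) p_proper ps).
  rewrite (conj_eq _ q g dg y b (B z) g_sub (esym qy) q_proper qs) -!EFinD.
  congr (_%:E); rewrite -xy innerDl !innerNl A_adj B_adj (innerC (As x)).
  by rewrite (innerC (Bs y)); ring.
split=> //; rewrite dualE; first exact: ltry.
move=> w _; rewrite /dual_obj.
apply: (@le_trans _ _ ((inner c w)%:E + (inner (- A w) x - (a + f x))%:E
                       + (inner (- B w) y - (b + g y))%:E)%E).
  rewrite -!EFinD lee_fin -xy innerDl !innerNl A_adj B_adj (innerC (As x)).
  by rewrite (innerC (Bs y)); lra.
by apply: leeD; [apply: leeD => //|]; exact: conj_lb.
Qed.

End kkt_optimality.

(** * Gradient inequalities from the two-sided majorization *)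

Section majorized_gradient.
Context (R : realType) (V : euclidType R).
Variables (f : V -> R) (df : V -> V) (Sl Su : {linear V -> V}).
Hypothesis Sl_psd : psd Sl.
Hypothesis f_minor : forall u u', f u' + inner (u - u') (df u')
                          + 2^-1 * sqnorm Sl (u - u') <= f u.
Hypothesis f_major : forall u u', f u <= f u' + inner (u - u') (df u')
                          + 2^-1 * sqnorm Su (u - u').

(** The gap between the two sides is [sqnorm G (u + v)]. *)
Lemma psd_sqnormB_le (G : {linear V -> V}) u v : psd G ->
  sqnorm G (u - v) <= 2 * sqnorm G u + 2 * sqnorm G v.
Proof.
move=> [_ G0]; have := G0 (u + v).
rewrite /sqnorm linearB linearD !innerE; lra.
Qed.

(** Polarization for the form of [G]: a proximal step paired with the new error becomes a difference
    of squared errors, which telescopes, plus the squared step. *)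
Lemma sqnormB_telescope (G : {linear V -> V}) u v : selfadjoint G ->
  2 * inner (G (u - v)) u = sqnorm G u - sqnorm G v + sqnorm G (u - v).
Proof.
move=> Gsa; rewrite /sqnorm linearB !innerE -(Gsa u u) -(Gsa v u) -(Gsa v v).
by rewrite (innerC u (G v)); ring.
Qed.

Lemma subgradient_of_minor u u' : f u' + inner (u - u') (df u') <= f u.
Proof.
have [_ S0] := Sl_psd; have := S0 (u - u'); have := f_minor u u'.
rewrite /sqnorm; lra.
Qed.

Lemma minor_le_major u : sqnorm Sl u <= sqnorm Su u.
Proof.
have := f_minor u 0; have := f_major u 0; rewrite !subr0; lra.
Qed.

(** Add the majorant at [u] evaluated in [u'], the minorant at [u] in [v] and the minorant at [v] in
    [u']. The function values cancel, and the two [Sl] squares sum to at least half that of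
    [u' - u]. In use, [u] and [u'] are consecutive iterates, with the gradient taken at the older
    one. *)
Lemma three_point u u' v :
  - 2^-1 * (sqnorm Su (u' - u) - 2^-1 * sqnorm Sl (u' - u))
  <= inner (df u - df v) (u' - v).
Proof.
have := f_major u' u; have := f_minor v u; have := f_minor u' v.
have := psd_sqnormB_le (u' - v) (u - v) Sl_psd.
have -> : u' - v - (u - v) = u' - u by rewrite opprB addrA subrK.
have -> : sqnorm Sl (v - u) = sqnorm Sl (u - v).
  by rewrite -opprB /sqnorm linearN !innerE; ring.
have -> : v - u = (u' - u) - (u' - v) by rewrite opprB [RHS]addrC addrA subrK.
move: (u' - v) (u' - u) (u - v) => a d e.
rewrite !innerE (innerC (df u)) (innerC (df v)).
set s1 := sqnorm _ _; set s2 := sqnorm _ _; set s3 := sqnorm _ _.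
set s4 := sqnorm _ _; lra.
Qed.

(* Compare the majorant at [u] with the minorant at [v] in the point [u + h], and
   the majorant at [v] with the minorant at [u] in the point [v - h]. *)
Lemma gradient_shift u v h :
  0 <= inner (df u - df v) (u - v) + 2 * inner (df u - df v) h + sqnorm Su h.
Proof.
have := f_major (u + h) u; have := subgradient_of_minor (u + h) v.
have := f_major (v - h) v; have := subgradient_of_minor (v - h) u.
have -> : u + h - u = h by rewrite addrAC subrr add0r.
have -> : v - h - v = - h by rewrite addrAC subrr add0r.
have -> : v - h - u = - ((u - v) + h) by rewrite opprD opprB addrAC.
have -> : u + h - v = (u - v) + h by rewrite addrAC.
have -> : sqnorm Su (- h) = sqnorm Su h.
  by rewrite /sqnorm linearN !innerE; ring.
move: (u - v) => d.
rewrite !innerE !(innerC h) !(innerC d); lra.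
Qed.

End majorized_gradient.

(* [beta (1 - beta) / (1 - 2 beta)] is the least coefficient for which this
   holds: the difference of the two sides is then a perfect square. *)
Lemma residual_split (R : realType) (Z : euclidType R) (a b : Z) (beta : R) :
  0 < beta < 2^-1 ->
  beta * `|a| ^+ 2 + beta * `|b| ^+ 2 <=
  `|b| ^+ 2 + beta * (1 - beta) / (1 - 2 * beta) * `|a + b| ^+ 2.
Proof.
move=> /andP[b0 b2]; have b3 : 0 < 1 - 2 * beta by lra.
rewrite -subr_ge0.
have -> : `|b| ^+ 2 + beta * (1 - beta) / (1 - 2 * beta) * `|a + b| ^+ 2
    - (beta * `|a| ^+ 2 + beta * `|b| ^+ 2)
  = (1 - 2 * beta)^-1 * `|beta *: a + (1 - beta) *: b| ^+ 2.
  by rewrite -!innerxx !innerE (innerC b a); field; exact: lt0r_neq0.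
by rewrite mulr_ge0 ?sqr_ge0// invr_ge0 ltW.
Qed.

(** * Algebra of the relaxed multiplier step *)

Section relaxed_dual_step.
Context (R : realType) (Z : euclidType R).

(** In use, [e], [a], [b], [b'] are the errors of [z k], [As (x k.+1)], [Bs (y k)] and
    [Bs (y k.+1)]. The first arguments of the two inner products are the multiplier errors seen by
    the two subproblems. *)
Lemma relaxed_dual_step_identity (s rho : R) (e a b b' : Z) :
  s != 0 -> rho != 0 ->
  (s * rho)^-1 * `|e + (s * (rho - 1)) *: b| ^+ 2 + s * (2 - rho) * `|b| ^+ 2
  - ((s * rho)^-1 * `|e + (s * (rho - 1)) *: b + (s * rho) *: (a + b')| ^+ 2
     + s * (2 - rho) * `|b'| ^+ 2)
  + 2 * inner (e + s *: (a + b)) a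
  + 2 * inner (e + s *: (rho *: (a + b) + (b' - b))) b'
  = s * (2 - rho) * `|a + b| ^+ 2.
Proof.
move=> s0 rho0; rewrite -!innerxx !innerE.
rewrite (innerC a e) (innerC b e) (innerC b' e) (innerC b a) (innerC b' a).
by rewrite (innerC b' b); field; rewrite s0 rho0.
Qed.

End relaxed_dual_step.

(** * Convergence of vectors through squared norms and linear maps *)

Section sequences_of_squares.
Context (R : realType) (V : euclidType R).

Lemma cvg0_of_sqr (u : nat -> V) (D : nat -> R) (c : R) : 0 < c ->
  (forall k, c * `|u k| ^+ 2 <= D k) -> D @ \oo --> 0 -> u @ \oo --> 0.
Proof.
move=> c0 uD D0; apply/norm_cvg0P; apply/cvgrPdist_lt => e e0.
have ce : 0 < c * e ^+ 2 by rewrite mulr_gt0// exprn_gt0.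
near=> k; rewrite sub0r normrN normr_id.
rewrite -(@ltr_pXn2r _ 2) ?nnegrE ?(ltW e0)// -(ltr_pM2l c0).
apply: le_lt_trans (uD k) _; apply: le_lt_trans (ler_norm _) _.
by rewrite -normrN -sub0r; near: k; move/cvgrPdist_lt : D0; exact.
Unshelve. all: by end_near. Qed.

Lemma cvg_sqr0 (u : nat -> V) :
  u @ \oo --> 0 -> (fun k => `|u k| ^+ 2) @ \oo --> 0.
Proof.
move=> u0; under eq_fun do rewrite -innerxx.
by rewrite -(inner0l (0 : V)); exact: cvg_inner.
Qed.

Lemma cvg_of_sub (u : nat -> V) (l : V) :
  (fun k => u k - l) @ \oo --> 0 -> u @ \oo --> l.
Proof.
move=> u0; have -> : u = (fun k => (u k - l) + l).
  by apply/funext => k; rewrite subrK.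
by rewrite -[X in _ --> X]add0r; apply: cvgD => //; exact: cvg_cst.
Qed.

Lemma cvg_sub0 (u : nat -> V) (l : V) :
  u @ \oo --> l -> (fun k => u k - l) @ \oo --> 0.
Proof. by move=> ul; rewrite -(subrr l); apply: cvgB => //; exact: cvg_cst. Qed.

End sequences_of_squares.

(** Reduces vector identities to scalar ones, which [ring] and [field] settle. *)
Lemma inner_ext (R : realType) (V : euclidType R) (u v : V) :
  (forall w, inner u w = inner v w) -> u = v.
Proof.
move=> uv; apply/eqP; rewrite -subr_eq0; apply/eqP/normr0_eq0/eqP.
rewrite -sqrf_eq0 -innerxx innerDl innerNl uv; apply/eqP; ring.
Qed.

Lemma cvg_linear (R : realType) (V W : euclidType R) (L : {linear V -> W})
    (u : nat -> V) (l : V) :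
  u @ \oo --> l -> (fun k => L (u k)) @ \oo --> L l.
Proof.
by move=> ul; apply: continuous_cvg => //; exact: linear_continuousE.
Qed.

Lemma cvg_linear0 (R : realType) (V W : euclidType R) (L : {linear V -> W})
    (u : nat -> V) :
  u @ \oo --> 0 -> (fun k => L (u k)) @ \oo --> 0.
Proof. by move=> /(cvg_linear (L := L)); rewrite linear0. Qed.

Lemma linear_sqr_bound (R : realType) (V W : euclidType R)
    (L : {linear V -> W}) :
  exists2 C : R, 0 < C & forall u, `|L u| ^+ 2 <= C * `|u| ^+ 2.
Proof.
have [C C0 CP] := linear_bound L; exists (C ^+ 2); first exact: exprn_gt0.
by move=> u; rewrite -exprMn lerXn2r ?nnegrE ?mulr_ge0 ?(ltW C0).
Qed.

(** * The MGADMM iterates: multiplier update and optimality conditions *)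

Section mgadmm_theory.
Context (R : realType) (X Y Z : euclidType R).
Variables (p : X -> \bar R) (q : Y -> \bar R) (f : X -> R) (g : Y -> R).
Variables (df : X -> X) (dg : Y -> Y).
Variables (A : {linear Z -> X}) (As : {linear X -> Z}).
Variables (B : {linear Z -> Y}) (Bs : {linear Y -> Z}) (c : Z).
Variables (Sf Sfh S : {linear X -> X}) (Sg Sgh T : {linear Y -> Y}).
Variables (rho sigma : R) (x : nat -> X) (y : nat -> Y) (z : nat -> Z).
Hypotheses (p_proper : Defs.proper p) (q_proper : Defs.proper q).
Hypotheses (p_convex : convex_efun p) (q_convex : convex_efun q).
Hypotheses (A_adj : adjoint A As) (B_adj : adjoint B Bs).
Hypotheses (Sf_psd : psd Sf) (Sfh_psd : psd Sfh).
Hypotheses (Sg_psd : psd Sg) (Sgh_psd : psd Sgh).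
Hypothesis f_minor : forall u u', f u' + inner (u - u') (df u')
                          + 2^-1 * sqnorm Sf (u - u') <= f u.
Hypothesis f_major : forall u u', f u <= f u' + inner (u - u') (df u')
                          + 2^-1 * sqnorm Sfh (u - u').
Hypothesis g_minor : forall v v', g v' + inner (v - v') (dg v')
                          + 2^-1 * sqnorm Sg (v - v') <= g v.
Hypothesis g_major : forall v v', g v <= g v' + inner (v - v') (dg v')
                          + 2^-1 * sqnorm Sgh (v - v').
Hypotheses (rho_gt0 : 0 < rho) (rho_lt2 : rho < 2) (sigma_gt0 : 0 < sigma).
Hypotheses (S_sa : selfadjoint S) (T_sa : selfadjoint T).
Hypothesis P_sa : selfadjoint (Sfh \+ S \+ sigma \*: (A \o As)).
Hypothesis Q_sa : selfadjoint (Sgh \+ T \+ sigma \*: (B \o Bs)).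
Hypothesis xyz : mgadmm p q df dg A As B Bs c rho sigma
  (Sfh \+ S \+ sigma \*: (A \o As)) (Sgh \+ T \+ sigma \*: (B \o Bs)) x y z.

Local Notation r k := (As (x k) + Bs (y k) - c).
Local Notation m k := (As (x k.+1) + Bs (y k) - c).
Local Notation dx k := (x k.+1 - x k).
Local Notation dy k := (y k.+1 - y k).

Lemma mgadmm_z k : z k.+1 = z k + sigma *: (rho *: m k + Bs (dy k)).
Proof.
case: xyz => _ _ /(_ k)[_ _ ->]; apply: inner_ext => w.
by rewrite !linearB !innerE; ring.
Qed.

Lemma mgadmm_dz k :
  z k.+1 - z k + (sigma * (rho - 1)) *: Bs (dy k) = (sigma * rho) *: r k.+1.
Proof.
rewrite mgadmm_z; apply: inner_ext => w.
by rewrite !linearB !innerE; ring.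
Qed.

(** In the optimality condition, the part [sigma \*: (A \o As)] of the proximal operator moves the
    residual from [x k] to [x k.+1]. This leaves [m k], with new [x] and old [y], in the
    multiplier. *)
Lemma mgadmm_x_subgradient k : subdifferential p (x k.+1)
  (- (df (x k) + A (z k + sigma *: m k) + (Sfh \+ S) (dx k))).
Proof.
case: xyz => _ _ /(_ k)[xmin _ _].
have := @argmin_quadratic _ _ p
  (Sfh \+ S \+ sigma \*: (A \o As) : {linear X -> X}) _ _
  p_proper p_convex P_sa xmin.
congr (subdifferential _ _ (- _)); apply: inner_ext => w.
rewrite /=; move: (x k.+1) => x'.
rewrite !(linearB, linearD, linearZ)/= !innerE; field; exact: lt0r_neq0.
Qed.

(** The part [sigma \*: (B \o Bs)] completes the multiplier to exactly [z k.+1]. *)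
Lemma mgadmm_y_subgradient k : subdifferential q (y k.+1)
  (- (dg (y k) + B (z k.+1) + (Sgh \+ T) (dy k))).
Proof.
rewrite mgadmm_z; case: xyz => _ _ /(_ k)[_ ymin _].
have := @argmin_quadratic _ _ q
  (Sgh \+ T \+ sigma \*: (B \o Bs) : {linear Y -> Y}) _ _
  q_proper q_convex Q_sa ymin.
congr (subdifferential _ _ (- _)); apply: inner_ext => w.
rewrite /=; move: (y k.+1) (x k.+1) => y' x'.
rewrite !(linearB, linearD, linearZ)/= !innerE; field.
by rewrite !lt0r_neq0.
Qed.

Local Notation phi xb yb zb k := (
  (sigma * rho)^-1 * `|z k - zb + (sigma * (rho - 1)) *: Bs (y k - yb)| ^+ 2
  + sqnorm (Sfh \+ S) (x k - xb)
  + sqnorm (Sgh \+ T \+ (sigma * (2 - rho)) \*: (B \o Bs)) (y k - yb)).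

(** * Descent inequalities at a fixed KKT point *)

Section descent.
Variables (xb : X) (yb : Y) (zb : Z).
Hypothesis wb_kkt : kkt p q df dg A As B Bs c (xb, yb, zb).

(** Polarization of the proximal terms yields the squared increments in [Sfh \+ S] and [Sgh \+ T].
    Taking the gradients at the old iterates costs [Sfh] minus half of [Sf], and [Sgh] minus half of
    [Sg]. *)
Lemma mgadmm_descent k :
  sqnorm (2^-1 \*: Sf \+ S) (dx k) + sqnorm (2^-1 \*: Sg \+ T) (dy k)
  + sigma * (2 - rho) * `|m k| ^+ 2 <= phi xb yb zb k - phi xb yb zb k.+1.
Proof.
have [ps qs xyb] := kkt_subgradients wb_kkt.
have := subdifferential_monotone p_proper (mgadmm_x_subgradient k) ps.
have := subdifferential_monotone q_proper (mgadmm_y_subgradient k) qs.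
have := three_point Sf_psd f_minor f_major (x k) (x k.+1) xb.
have := three_point Sg_psd g_minor g_major (y k) (y k.+1) yb.
have subE (V : euclidType R) (u u' v : V) : u' - u = (u' - v) - (u - v).
  by rewrite opprB addrA subrK.
have mE : m k = As (x k.+1 - xb) + Bs (y k - yb).
  by rewrite -xyb !linearB/=; apply: inner_ext => w; rewrite !innerE; ring.
have zE : z k.+1 = z k + sigma *: (rho *: (As (x k.+1 - xb) + Bs (y k - yb))
    + (Bs (y k.+1 - yb) - Bs (y k - yb))).
  by rewrite mgadmm_z mE -linearB -subE.
have phiE : z k.+1 - zb + (sigma * (rho - 1)) *: Bs (y k.+1 - yb) =
    z k - zb + (sigma * (rho - 1)) *: Bs (y k - yb)
    + (sigma * rho) *: (As (x k.+1 - xb) + Bs (y k.+1 - yb)).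
  by rewrite zE; apply: inner_ext => w; rewrite !innerE; ring.
have := relaxed_dual_step_identity (z k - zb) (As (x k.+1 - xb))
  (Bs (y k - yb)) (Bs (y k.+1 - yb)) (lt0r_neq0 sigma_gt0) (lt0r_neq0 rho_gt0).
rewrite phiE mE.
have -> : A (z k + sigma *: (As (x k.+1 - xb) + Bs (y k - yb))) =
    A (z k - zb + sigma *: (As (x k.+1 - xb) + Bs (y k - yb))) + A zb.
  by rewrite -linearD addrAC subrK.
have -> : B (z k.+1) =
    B (z k - zb + sigma *: (rho *: (As (x k.+1 - xb) + Bs (y k - yb))
       + (Bs (y k.+1 - yb) - Bs (y k - yb)))) + B zb.
  by rewrite zE -linearD addrAC subrK.
rewrite !sqnormE !(sqnorm_adj _ B_adj).
have := sqnormB_telescope (x k.+1 - xb) (x k - xb) Sfh_psd.1.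
have := sqnormB_telescope (x k.+1 - xb) (x k - xb) S_sa.
have := sqnormB_telescope (y k.+1 - yb) (y k - yb) Sgh_psd.1.
have := sqnormB_telescope (y k.+1 - yb) (y k - yb) T_sa.
rewrite -!subE /=.
set ex := x k - xb; set ex' := x k.+1 - xb.
set ey := y k - yb; set ey' := y k.+1 - yb; set e := z k - zb.
(* Separates the gradient, multiplier and proximal parts of each monotonicity inequality. *)
have monoE (V : euclidType R) (a a' b b' v w : V) :
    inner (- (a + (b + b') + v) - - (a' + b')) w =
    - (inner (a - a') w + inner b w + inner v w) by rewrite !innerE; ring.
rewrite !monoE A_adj B_adj (innerDl (Sfh _)) (innerDl (Sgh _)).
set n1 := `|_| ^+ 2; set n2 := `|_| ^+ 2; set n3 := `|_| ^+ 2.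
set n4 := `|_| ^+ 2; set n5 := `|_| ^+ 2; set w := (sigma * rho)^-1.
lra.
Qed.

Lemma mgadmm_descent_beta (beta mu : R) k : 0 < beta < 2^-1 ->
  mu = beta * (1 - beta) / (1 - 2 * beta) ->
  sqnorm (2^-1 \*: Sf \+ S \+ (sigma * beta * (2 - rho)) \*: (A \o As)) (dx k)
  + sqnorm (2^-1 \*: Sg \+ T) (dy k)
  <= phi xb yb zb k + sigma * mu * (2 - rho) * `|r k| ^+ 2 - phi xb yb zb k.+1.
Proof.
move=> beta01 muE; have := mgadmm_descent k.
have mE : r k = - As (dx k) + m k.
  by rewrite linearB; apply: inner_ext => w; rewrite !innerE; ring.
have s2 : 0 <= sigma * (2 - rho).
  by rewrite mulr_ge0 ?subr_ge0 ?(ltW sigma_gt0) ?(ltW rho_lt2).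
(* The two vectors [- As (dx k)] and [m k] sum to the old residual [r k]; the surplus [beta] times
   the square of [m k] is dropped at the end. *)
have := residual_split (- As (dx k)) (m k) beta01.
rewrite -mE -muE normrN => hres; have := ler_wpM2l s2 hres.
have b0 : 0 <= beta by case/andP: beta01 => /ltW.
have := mulr_ge0 s2 (mulr_ge0 b0 (sqr_ge0 `|m k|)).
move: (phi xb yb zb k) (phi xb yb zb k.+1) => F F'.
rewrite !sqnormE !(sqnorm_adj _ A_adj); lra.
Qed.

(** Both multiplier terms are multiples of the new squared residual, and their difference is
    [- sigma * mu * (2 - rho)] times it. The operators added and subtracted cancel down to those of
    [mgadmm_descent_beta]. *)
Lemma mgadmm_inequality1 (beta mu : R) k : 0 < beta < 2^-1 ->
  mu = beta * (1 - beta) / (1 - 2 * beta) ->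
  (sigma * rho ^+ 2)^-1
    * `|z k.+1 - z k + (sigma * (rho - 1)) *: Bs (dy k)| ^+ 2
  + sqnorm (Sfh \+ S \+ (sigma * beta * (2 - rho)) \*: (A \o As)) (dx k)
  + sqnorm (Sgh \+ T \+ (sigma * beta * (2 - rho)) \*: (B \o Bs)) (dy k)
  - ((1 + 2 * mu - mu * rho) / (sigma * rho ^+ 2)
       * `|z k.+1 - z k + (sigma * (rho - 1)) *: Bs (dy k)| ^+ 2
     + sqnorm (Sfh \- 2^-1 \*: Sf) (dx k)
     + sqnorm (Sgh \- 2^-1 \*: Sg \+ (sigma * beta * (2 - rho)) \*: (B \o Bs))
         (dy k))
  <= (phi xb yb zb k + sigma * mu * (2 - rho) * `|r k| ^+ 2)
     - (phi xb yb zb k.+1 + sigma * mu * (2 - rho) * `|r k.+1| ^+ 2).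
Proof.
move=> beta01 muE; rewrite mgadmm_dz.
have -> : `|(sigma * rho) *: r k.+1| ^+ 2 = (sigma * rho) ^+ 2 * `|r k.+1| ^+ 2.
  by rewrite -!innerxx !innerE expr2 mulrA.
have s0 := lt0r_neq0 sigma_gt0; have rho0 := lt0r_neq0 rho_gt0.
have -> t : t / (sigma * rho ^+ 2) * ((sigma * rho) ^+ 2 * `|r k.+1| ^+ 2) =
    t * sigma * `|r k.+1| ^+ 2 by field; rewrite s0 rho0.
have -> : (sigma * rho ^+ 2)^-1 * ((sigma * rho) ^+ 2 * `|r k.+1| ^+ 2) =
    sigma * `|r k.+1| ^+ 2 by field; rewrite s0 rho0.
have := mgadmm_descent_beta k beta01 muE.
move: (phi xb yb zb k) (phi xb yb zb k.+1) => F F'.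
rewrite !sqnormE !(sqnorm_adj _ B_adj) !(sqnorm_adj _ A_adj); lra.
Qed.

(** Monotonicity at two consecutive iterates is doubled. Polarization then provides the [Sgh \+ T]
    square of [dy k.+1 - dy k], while the gradients cost half of its [Sgh] square; what is left is
    nonnegative by hypothesis. *)
Lemma dual_increment_ge0 k : psd (2^-1 \*: Sgh \+ T) ->
  0 <= - 2 * inner (z k.+2 - z k.+1) (Bs (dy k.+1))
       + sqnorm (Sgh \+ T) (dy k) - sqnorm (Sgh \+ T) (dy k.+1).
Proof.
move=> [_ /(_ (dy k.+1 - dy k)) Tlb].
have := subdifferential_monotone q_proper (mgadmm_y_subgradient k.+1)
  (mgadmm_y_subgradient k).
(* With half the change of increment as shift, [dy k] plus twice the shift is [dy k.+1], the vector
   paired with the gradients by monotonicity. *)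
have := gradient_shift Sg_psd g_minor g_major (y k.+1) (y k)
  (2^-1 *: (dy k.+1 - dy k)).
move: Tlb; rewrite -B_adj (linearB B) -/(sqnorm _ _).
move: (dg (y k.+1)) (dg (y k)) (B (z k.+2)) (B (z k.+1)) => a a' b b'.
move: (y k.+2 - y k.+1) (y k.+1 - y k) => d' d.
have -> : sqnorm Sgh (2^-1 *: (d' - d)) = 4^-1 * sqnorm Sgh (d' - d).
  by rewrite /sqnorm linearZ/= !innerE; field.
rewrite !sqnormE/=.
have sqE (G : {linear Y -> Y}) : selfadjoint G ->
    sqnorm G (d' - d) = sqnorm G d' + sqnorm G d - 2 * inner (G d) d'.
  move=> Gsa; rewrite /sqnorm linearB/= !innerE -(Gsa d d') (innerC d' (G d)).
  by ring.
rewrite (sqE _ T_sa) (sqE _ Sgh_psd.1).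
rewrite !innerE /sqnorm (innerC d' (Sgh d')) (innerC d' (T d')); lra.
Qed.

(** The square of [m k.+1] is shared out. The share [1 - lam] bounds the square of [As (dx k.+1)] up
    to the old residual; the share [lam] is expanded around the new residual, with the cross term
    controlled by [dual_increment_ge0]. *)
Lemma mgadmm_inequality2 (lam : R) k :
  psd (2^-1 \*: Sgh \+ T) -> 0 < lam <= 1 ->
  sqnorm (2^-1 \*: Sf \+ S
          \+ (2^-1 * sigma * (1 - lam) * (2 - rho)) \*: (A \o As)) (dx k.+1)
  + sqnorm (2^-1 \*: Sg \+ T
          \+ (sigma * (lam * (2 - rho) ^+ 2 / rho)) \*: (B \o Bs)) (dy k.+1)
  + sigma * (2 * lam - 1) * (2 - rho) * `|r k.+2| ^+ 2
  <= (phi xb yb zb k.+1 + sigma * (1 - lam) * (2 - rho) * `|r k.+1| ^+ 2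
      + lam * (2 - rho) / rho * sqnorm (Sgh \+ T) (dy k))
     - (phi xb yb zb k.+2 + sigma * (1 - lam) * (2 - rho) * `|r k.+2| ^+ 2
        + lam * (2 - rho) / rho * sqnorm (Sgh \+ T) (dy k.+1)).
Proof.
move=> Tpsd /andP[lam0 lam1].
have rho2 : 0 <= 2 - rho by rewrite subr_ge0 (ltW rho_lt2).
have c1 : 0 <= sigma * (1 - lam) * (2 - rho).
  by rewrite !mulr_ge0// ?subr_ge0// ltW.
have c2 : 0 <= lam * (2 - rho) / rho.
  by rewrite divr_ge0 ?mulr_ge0 ?(ltW lam0) ?(ltW rho_gt0).
have := mulr_ge0 c2 (dual_increment_ge0 k Tpsd).
have zE : z k.+2 - z k.+1 =
    (sigma * rho) *: r k.+2 - (sigma * (rho - 1)) *: Bs (dy k.+1).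
  by rewrite -mgadmm_dz addrK.
rewrite {}zE.
(* The square of [Bs (dy k.+1)] is split so that the first bracket is the one in the expansion of
   [m k.+1]; the rest carries the coefficient of [B \o Bs] in the claim. *)
have -> : lam * (2 - rho) / rho * (- 2 * inner ((sigma * rho) *: r k.+2
        - (sigma * (rho - 1)) *: Bs (dy k.+1)) (Bs (dy k.+1))
      + sqnorm (Sgh \+ T) (dy k) - sqnorm (Sgh \+ T) (dy k.+1)) =
    lam * (2 - rho) * sigma * (`|Bs (dy k.+1)| ^+ 2
      - 2 * inner (r k.+2) (Bs (dy k.+1)))
    - sigma * (lam * (2 - rho) ^+ 2 / rho) * `|Bs (dy k.+1)| ^+ 2
    + lam * (2 - rho) / rho * sqnorm (Sgh \+ T) (dy k)
    - lam * (2 - rho) / rho * sqnorm (Sgh \+ T) (dy k.+1).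
  rewrite innerDl innerNl !innerZl innerxx; field; exact: lt0r_neq0.
have := mgadmm_descent k.+1.
have mE : m k.+1 = r k.+2 - Bs (dy k.+1).
  by rewrite linearB; apply: inner_ext => w; rewrite !innerE; ring.
have AE : As (dx k.+1) = m k.+1 + (- r k.+1).
  by rewrite linearB; apply: inner_ext => w; rewrite !innerE; ring.
have := ler_wpM2l c1 (normD_sqr_le (m k.+1) (- r k.+1)).
rewrite -AE normrN.
have nB (u v : Z) : `|u - v| ^+ 2 = `|u| ^+ 2 + (`|v| ^+ 2 - 2 * inner u v).
  by rewrite -!innerxx !innerE (innerC v u); ring.
rewrite mE nB.
move: (phi xb yb zb k.+1) (phi xb yb zb k.+2) => F F'.
move: (lam * (2 - rho) / rho * sqnorm (Sgh \+ T) (dy k)) => G.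
move: (lam * (2 - rho) / rho * sqnorm (Sgh \+ T) (dy k.+1)) => G'.
move: (`|Bs (dy k.+1)| ^+ 2 - 2 * inner (r k.+2) (Bs (dy k.+1))) => D.
rewrite !sqnormE !(sqnorm_adj _ B_adj) !(sqnorm_adj _ A_adj).
move: (sigma * (lam * (2 - rho) ^+ 2 / rho)) => l; lra.
Qed.

End descent.

Hypotheses (p_lsc : lower_semicontinuous p) (q_lsc : lower_semicontinuous q).
Hypotheses (df_cont : continuous df) (dg_cont : continuous dg).

Local Notation dist2 xb yb zb k :=
  (`|x k - xb| ^+ 2 + `|y k - yb| ^+ 2 + `|z k - zb| ^+ 2).

(** * Cluster points and convergence once the increments vanish *)

Section vanishing_increments.
Hypothesis dx0 : (fun k => dx k) @ \oo --> 0.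
Hypothesis dy0 : (fun k => dy k) @ \oo --> 0.
Hypothesis r0 : (fun k => r k) @ \oo --> 0.

Lemma mgadmm_cluster_kkt (h : nat -> nat) (x' : X) (y' : Y) (z' : Z) :
  (forall n, n <= h n)%N -> (fun n => x (h n)) @ \oo --> x' ->
  (fun n => y (h n)) @ \oo --> y' -> (fun n => z (h n)) @ \oo --> z' ->
  kkt p q df dg A As B Bs c (x', y', z').
Proof.
move=> hn xx' yy' zz'.
have dxh := cvg_subseq hn dx0; have dyh := cvg_subseq hn dy0.
have rh := cvg_subseq hn r0.
(* The subgradients at the new iterates involve this mixed residual and the indices [(h n).+1];
   vanishing increments leave the limits unchanged. *)
have mh : (fun n => As (x (h n).+1) + Bs (y (h n)) - c) @ \oo --> 0.
  have -> : (fun n => As (x (h n).+1) + Bs (y (h n)) - c) =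
      (fun n => (As (x (h n)) + Bs (y (h n)) - c)
                + As (x (h n).+1 - x (h n))).
    by apply/funext => n; rewrite linearB; apply: inner_ext => w;
      rewrite !innerE; ring.
  by rewrite -[X in _ --> X]addr0; apply: cvgD => //; exact: cvg_linear0.
have x1 : (fun n => x (h n).+1) @ \oo --> x'.
  have -> : (fun n => x (h n).+1) = (fun n => (x (h n).+1 - x (h n)) + x (h n)).
    by apply/funext => n; rewrite subrK.
  by rewrite -[X in _ --> X]add0r; apply: cvgD.
have y1 : (fun n => y (h n).+1) @ \oo --> y'.
  have -> : (fun n => y (h n).+1) = (fun n => (y (h n).+1 - y (h n)) + y (h n)).
    by apply/funext => n; rewrite subrK.
  by rewrite -[X in _ --> X]add0r; apply: cvgD.
have z1 : (fun n => z (h n).+1) @ \oo --> z'.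
  under eq_fun do rewrite (mgadmm_z).
  rewrite -[z']addr0; apply: cvgD => //.
  rewrite -(scaler0 _ sigma); apply: cvgZl_tmp.
  rewrite -[0]addr0; apply: cvgD; last exact: cvg_linear0.
  by rewrite -(scaler0 _ rho); apply: cvgZl_tmp.
have ps : subdifferential p x' (- (df x' + A z')).
  have sub n := mgadmm_x_subgradient (h n).
  refine (subdifferential_closed p_lsc p_proper sub x1 _).
  apply: cvgN; rewrite -[df x' + _]addr0; apply: cvgD; last exact: cvg_linear0.
  apply: cvgD; first by apply: continuous_cvg => //; exact: df_cont.
  apply: cvg_linear; rewrite -[X in _ --> X]addr0; apply: cvgD => //.
  by rewrite -(scaler0 _ sigma); apply: cvgZl_tmp.
have qs : subdifferential q y' (- (dg y' + B z')).
  have sub n := mgadmm_y_subgradient (h n).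
  refine (subdifferential_closed q_lsc q_proper sub y1 _).
  apply: cvgN; rewrite -[dg y' + _]addr0; apply: cvgD; last exact: cvg_linear0.
  apply: cvgD; first by apply: continuous_cvg => //; exact: dg_cont.
  exact: cvg_linear.
split.
- by exists (- (df x' + A z')) => //; rewrite -addrA addNr.
- by exists (- (dg y' + B z')) => //; rewrite -addrA addNr.
- have lim : (fun n => As (x (h n)) + Bs (y (h n)) - c) @ \oo -->
      As x' + Bs y' - c.
    by apply: cvgB; [apply: cvgD; exact: cvg_linear|exact: cvg_cst].
  by apply/eqP; rewrite -subr_eq0; apply/eqP; exact: cvg_unique lim rh.
Qed.

(* Along a convergent subsequence the limit is a KKT point; the potential [L] at
   that point converges and vanishes along the subsequence, hence vanishes. *)
Lemma mgadmm_cvg_kkt (L : X -> Y -> Z -> nat -> R) (e : nat -> R) (C C' : R)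
    (xb : X) (yb : Y) (zb : Z) : 0 < C -> e @ \oo --> 0 ->
  kkt p q df dg A As B Bs c (xb, yb, zb) ->
  (forall x' y' z', kkt p q df dg A As B Bs c (x', y', z') ->
   [/\ cvgn (L x' y' z'),
       forall k, dist2 x' y' z' k <= C * (L x' y' z' k + e k)
     & forall k, L x' y' z' k <= C' * (dist2 x' y' z' k + e k)]) ->
  exists x' y' z', [/\ kkt p q df dg A As B Bs c (x', y', z'),
    x @ \oo --> x', y @ \oo --> y' & z @ \oo --> z'].
Proof.
move=> C0 e0 wb LP.
have [Lcvg distL _] := LP _ _ _ wb.
have : cvgn (fun k => L xb yb zb k + e k).
  by apply: is_cvgD => //; apply/cvg_ex; exists 0.
move=> /cvg_seq_bounded/pinfty_ex_gt0[M M0 LM].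
have bound (V : euclidType R) (u : nat -> V) (u' : V) :
    (forall k, `|u k - u'| ^+ 2 <= dist2 xb yb zb k) ->
    forall k, `|u k| <= (1 + C * M) + `|u'|.
  move=> ud k; rewrite -[u k](subrK u') (le_trans (ler_normD _ _))// lerD2r.
  have uC : `|u k - u'| ^+ 2 <= C * M.
    rewrite (le_trans (ud k))// (le_trans (distL k))// ler_pM2l//.
    by rewrite (le_trans (ler_norm _))//; exact: LM.
  (* From [(t - 1)^2 >= 0] and [t^2 <= C * M] with [t >= 0] follows [t <= 1 + C * M]. *)
  have := sqr_ge0 (`|u k - u'| - 1); have := normr_ge0 (u k - u'); nra.
have xM : forall k, `|x k| <= 1 + C * M + `|xb|.
  by apply: bound => k; rewrite -addrA lerDl addr_ge0 ?sqr_ge0.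
have yM : forall k, `|y k| <= 1 + C * M + `|yb|.
  by apply: bound => k; rewrite addrAC lerDr addr_ge0 ?sqr_ge0.
have zM : forall k, `|z k| <= 1 + C * M + `|zb|.
  by apply: bound => k; rewrite lerDr addr_ge0 ?sqr_ge0.
have [x' [h1 h1n xx']] := bolzano_weierstrass xM.
have [y' [h2 h2n yy']] := bolzano_weierstrass (fun n => yM (h1 n)).
have [z' [h3 h3n zz']] := bolzano_weierstrass (fun n => zM (h1 (h2 n))).
pose h n := h1 (h2 (h3 n)).
have hn n : (n <= h n)%N by rewrite (leq_trans (h3n n))// (leq_trans (h2n _)).
have {}yy' : (fun n => y (h n)) @ \oo --> y' := cvg_subseq h3n yy'.
have h23 n : (n <= h2 (h3 n))%N by rewrite (leq_trans (h3n n)).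
have {}xx' : (fun n => x (h n)) @ \oo --> x' := cvg_subseq h23 xx'.
have w' := mgadmm_cluster_kkt hn xx' yy' zz'.
exists x', y', z'; have [Lcvg' distL' Ldist] := LP _ _ _ w'.
set D := fun k => dist2 x' y' z' k.
have D0 k : 0 <= D k by rewrite !addr_ge0 ?sqr_ge0.
have Dh : (fun n => D (h n)) @ \oo --> 0.
  rewrite -[0]addr0; apply: cvgD; last exact/cvg_sqr0/cvg_sub0.
  by rewrite -[0]addr0; apply: cvgD; exact/cvg_sqr0/cvg_sub0.
have L0 : L x' y' z' @ \oo --> 0.
  apply: (cvgn_subseq_eq hn Lcvg').
  (* Only [L + e] is known to be nonnegative, hence the lower bound [- e]. *)
  apply: (@squeeze_cvgr _ _ _ _ (fun n => - e (h n))
    (fun n => C' * (D (h n) + e (h n)))).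
  - apply: nearW => n; rewrite [X in _ && X]Ldist andbT.
    have := le_trans (D0 (h n)) (distL' (h n)); rewrite pmulr_rge0//; lra.
  - by rewrite -oppr0; apply: cvgN; exact: cvg_subseq hn e0.
  - rewrite -(mulr0 C'); apply: cvgMl_tmp; rewrite -[0]addr0; apply: cvgD => //.
    exact: cvg_subseq hn e0.
have CL0 : (fun k => C * (L x' y' z' k + e k)) @ \oo --> 0.
  by rewrite -(mulr0 C); apply: cvgMl_tmp; rewrite -[0]addr0; apply: cvgD.
split=> //; apply: cvg_of_sub; apply: (cvg0_of_sqr ltr01 _ CL0) => k;
  rewrite mul1r; apply: le_trans (distL' k);
  have := sqr_ge0 `|x k - x'|; have := sqr_ge0 `|y k - y'|;
  have := sqr_ge0 `|z k - z'|; lra.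
Qed.

End vanishing_increments.

(** * Potential against distance, and the two convergence results *)

Let w_gt0 : 0 < (sigma * rho)^-1.
Proof. by rewrite invr_gt0 mulr_gt0. Qed.

Let s2_gt0 : 0 < sigma * (2 - rho).
Proof. by rewrite mulr_gt0 ?subr_gt0. Qed.

Lemma phi_le_dist2 : exists2 C : R, 0 < C &
  forall xb yb zb k, phi xb yb zb k <= C * dist2 xb yb zb k.
Proof.
have [C1 C10 xC] := sqnorm_bound (Sfh \+ S : {linear X -> X}).
have [C2 C20 yC] := sqnorm_bound
  (Sgh \+ T \+ (sigma * (2 - rho)) \*: (B \o Bs) : {linear Y -> Y}).
have [K K0 zK] := linear_sqr_bound
  ((sigma * (rho - 1)) \*: Bs : {linear Y -> Z}).
exists ((sigma * rho)^-1 * 2 * (1 + K) + C1 + C2).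
  by rewrite !addr_gt0// !mulr_gt0// addr_gt0.
move=> xb yb zb k.
have := xC (x k - xb); have := yC (y k - yb); have := zK (y k - yb).
have /= := normD_sqr_le (z k - zb) ((sigma * (rho - 1)) *: Bs (y k - yb)).
have := sqr_ge0 `|x k - xb|; have := sqr_ge0 `|y k - yb|.
have := sqr_ge0 `|z k - zb|.
set u := `|x k - xb| ^+ 2; set v := `|y k - yb| ^+ 2; set t := `|z k - zb| ^+ 2.
set W := `|_ + _| ^+ 2; set N := `|_ *: _| ^+ 2.
move: w_gt0 (sqnorm _ _) (sqnorm _ _); move: (sigma * rho)^-1 => w w0 Q1 Q2.
move=> t0 v0 u0 hW hN h2 h1.
have := ler_wpM2l (ltW w0) (le_trans hW (_ : _ <= 2 * t + 2 * (K * v))).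
move=> /(_ ltac:(lra)) hw.
have := mulr_ge0 (mulr_ge0 (ltW w0) (ltW K0)) t0.
have := mulr_ge0 (mulr_ge0 (ltW w0) (ltW K0)) u0.
have := mulr_ge0 (ltW w0) v0; have := mulr_ge0 (ltW w0) u0.
have := mulr_ge0 (ltW C10) v0; have := mulr_ge0 (ltW C10) t0.
have := mulr_ge0 (ltW C20) u0; have := mulr_ge0 (ltW C20) t0.
lra.
Qed.

(** The potential sees [z] only combined with [Bs]; undoing this costs the error of [y]. *)
Lemma dist_z_le : exists2 C : R, 0 < C & forall yb zb k,
  `|z k - zb| ^+ 2 <= C * ((sigma * rho)^-1
    * `|z k - zb + (sigma * (rho - 1)) *: Bs (y k - yb)| ^+ 2
    + `|y k - yb| ^+ 2).
Proof.
have [K K0 zK] := linear_sqr_bound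
  ((sigma * (rho - 1)) \*: Bs : {linear Y -> Z}).
exists (2 * (sigma * rho) + 2 * K); first by rewrite addr_gt0 ?mulr_gt0.
move=> yb zb k; have /= := zK (y k - yb).
have := normD_sqr_le (z k - zb + (sigma * (rho - 1)) *: Bs (y k - yb))
  (- ((sigma * (rho - 1)) *: Bs (y k - yb))).
rewrite addrK normrN.
have := sqr_ge0 `|z k - zb + (sigma * (rho - 1)) *: Bs (y k - yb)|.
have := sqr_ge0 `|y k - yb|.
set v := `|y k - yb| ^+ 2; set t := `|z k - zb| ^+ 2.
set W := `|_ + _| ^+ 2; set N := `|_ *: _| ^+ 2.
move=> v0 W0 h1 h2.
have sr := mulr_gt0 sigma_gt0 rho_gt0.
have := mulr_ge0 (ltW sr) v0.
have := mulr_ge0 (mulr_ge0 (ltW K0) (ltW w_gt0)) W0.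
have : sigma * rho * ((sigma * rho)^-1 * W) = W.
  by rewrite mulVKf// lt0r_neq0.
lra.
Qed.

Lemma summable_increments_cvg (beta : R) (xb : X) (yb : Y) (zb : Z) :
  0 < beta < 2^-1 -> kkt p q df dg A As B Bs c (xb, yb, zb) ->
  pd (Sfh \+ S \+ (sigma * beta * (2 - rho)) \*: (A \o As)) ->
  pd (Sgh \+ T \+ (sigma * beta * (2 - rho)) \*: (B \o Bs)) ->
  (\sum_(0 <= k <oo) (sqnorm Sfh (dx k)
     + sqnorm (Sgh \+ (sigma * (2 - rho)) \*: (B \o Bs)) (dy k)
     + `|r k.+1| ^+ 2)%:E < +oo)%E ->
  exists x' y' z', [/\ kkt p q df dg A As B Bs c (x', y', z'),
    x @ \oo --> x', y @ \oo --> y' & z @ \oo --> z'].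
Proof.
move=> beta01 wb PA_pd PB_pd asum.
have [b0 b2] := andP beta01.
have a0 k : 0 <= sqnorm Sfh (dx k) /\
    0 <= sqnorm (Sgh \+ (sigma * (2 - rho)) \*: (B \o Bs)) (dy k).
  split; first exact: Sfh_psd.2.
  rewrite sqnormD sqnormZ (sqnorm_adj _ B_adj) addr_ge0//.
    exact: Sgh_psd.2.
  by rewrite mulr_ge0 ?sqr_ge0// ltW.
pose a k := sqnorm Sfh (dx k)
  + sqnorm (Sgh \+ (sigma * (2 - rho)) \*: (B \o Bs)) (dy k) + `|r k.+1| ^+ 2.
have acvg : cvgn (series a).
  apply: nneseries_cvg_series => // k.
  by have [? ?] := a0 k; rewrite !addr_ge0 ?sqr_ge0.
have r0 : (fun k => r k) @ \oo --> 0.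
  rewrite -cvg_shiftS.
  apply: (cvg0_of_sqr ltr01 _ (cvg_series_cvg_0 acvg)) => k.
  by rewrite mul1r /a; have [? ?] := a0 k; lra.
pose mu := beta * (1 - beta) / (1 - 2 * beta).
have mu0 : 0 < mu by apply: divr_gt0; [apply: mulr_gt0|]; lra.
have smu0 : 0 < sigma * mu * (2 - rho) by rewrite mulrAC mulr_gt0.
have [cA cA0 xA] := pd_coercive PA_pd.
have [cB cB0 yB] := pd_coercive PB_pd.
pose L x' y' z' k := phi x' y' z' k + sigma * mu * (2 - rho) * `|r k| ^+ 2.
have L_lb x' y' z' k : kkt p q df dg A As B Bs c (x', y', z') ->
    [/\ cA * `|x k - x'| ^+ 2 <= L x' y' z' k,
        cB * `|y k - y'| ^+ 2 <= L x' y' z' k &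
        (sigma * rho)^-1
          * `|z k - z' + (sigma * (rho - 1)) *: Bs (y k - y')| ^+ 2
          <= L x' y' z' k].
  move=> /kkt_subgradients[_ _ w'].
  have rE : r k = As (x k - x') + Bs (y k - y').
    by rewrite -w' !linearB; apply: inner_ext => w; rewrite !innerE; ring.
  (* The residual is the sum of the two errors, so [residual_split] trades the [Bs] square in [phi]
     and the residual term for [beta] times both squares. This makes [L] coercive even where
     [Sfh \+ S] or [Sgh \+ T] is indefinite. *)
  have := ler_wpM2l (ltW s2_gt0)
    (residual_split (As (x k - x')) (Bs (y k - y')) beta01).
  rewrite -rE -/mu => hres.
  have hA := xA (x k - x'); have hB := yB (y k - y').
  have hA0 := mulr_ge0 (ltW cA0) (sqr_ge0 `|x k - x'|).
  have hB0 := mulr_ge0 (ltW cB0) (sqr_ge0 `|y k - y'|).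
  have hW := mulr_ge0 (ltW w_gt0)
    (sqr_ge0 `|z k - z' + (sigma * (rho - 1)) *: Bs (y k - y')|).
  move: hA hB hW; rewrite /L.
  set W := (sigma * rho)^-1 * _; clearbody W.
  rewrite !sqnormE !(sqnorm_adj _ B_adj) !(sqnorm_adj _ A_adj) => hA hB hW.
  by split; lra.
(* The summand 1 pays for replacing half of [Sf] and of [Sg] by [Sfh] and [Sgh] with its [Bs] term;
   the other summand pays for the new residual in [L]. *)
pose C0 := 1 + sigma * mu * (2 - rho).
pose D k := sqnorm (Sfh \+ S \+ (sigma * beta * (2 - rho)) \*: (A \o As)) (dx k)
  + sqnorm (Sgh \+ T \+ (sigma * beta * (2 - rho)) \*: (B \o Bs)) (dy k).
have D_lb k : cA * `|dx k| ^+ 2 <= D k /\ cB * `|dy k| ^+ 2 <= D k.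
  have := xA (dx k); have := yB (dy k).
  have := mulr_ge0 (ltW cA0) (sqr_ge0 `|dx k|).
  have := mulr_ge0 (ltW cB0) (sqr_ge0 `|dy k|).
  by rewrite /D; split; lra.
have LD x' y' z' : kkt p q df dg A As B Bs c (x', y', z') ->
    cvgn (L x' y' z') /\ D @ \oo --> 0.
  move=> w'; apply: (@fejer_monotone_cvg _ _ (fun k => C0 * a k)).
  - move=> k; have [h _ _] := L_lb _ _ _ k w'; apply: le_trans h.
    by rewrite mulr_ge0 ?sqr_ge0// ltW.
  - move=> k; apply: mulr_ge0; first by rewrite addr_ge0// ltW.
    by have [? ?] := a0 k; rewrite !addr_ge0 ?sqr_ge0.
  - move=> k; have [h _] := D_lb k; apply: le_trans h.
    by rewrite mulr_ge0 ?sqr_ge0// ltW.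
  - move=> k; have := mgadmm_descent_beta w' k beta01 (erefl mu).
    have [_ Sf0] := Sf_psd; have [_ Sg0] := Sg_psd.
    have := Sf0 (dx k); have := Sg0 (dy k); rewrite -!/(sqnorm _ _).
    have := mulr_ge0 (ltW smu0) (addr_ge0 (a0 k).1 (a0 k).2).
    have := sqr_ge0 `|r k.+1|.
    have bB : sigma * beta * (2 - rho) * `|Bs (dy k)| ^+ 2 <=
        sigma * (2 - rho) * `|Bs (dy k)| ^+ 2.
      have := mulr_ge0 (mulr_ge0 (ltW s2_gt0) (sqr_ge0 `|Bs (dy k)|))
        (_ : 0 <= 1 - beta).
      by move=> /(_ ltac:(lra)); lra.
    move: bB; rewrite /L /D /C0 /a.
    move: (phi x' y' z' k) (phi x' y' z' k.+1) => F F'.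
    by rewrite !sqnormE !(sqnorm_adj _ B_adj) !(sqnorm_adj _ A_adj); lra.
  - exact: is_cvg_seriesZ.
have [_ D0] := LD _ _ _ wb.
have dx0 := cvg0_of_sqr cA0 (fun k => (D_lb k).1) D0.
have dy0 := cvg0_of_sqr cB0 (fun k => (D_lb k).2) D0.
have [K K0 zK] := dist_z_le; have [Cp Cp0 phiC] := phi_le_dist2.
have cAi : 0 < cA^-1 by rewrite invr_gt0.
have cBi : 0 < cB^-1 by rewrite invr_gt0.
apply: (mgadmm_cvg_kkt (L := L) (e := fun k => `|r k| ^+ 2)
  (C := cA^-1 + cB^-1 + K * (1 + cB^-1)) (C' := Cp + sigma * mu * (2 - rho))
  dx0 dy0 r0 _ (cvg_sqr0 r0) wb).
  by rewrite !addr_gt0// mulr_gt0// addr_gt0.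
move=> x' y' z' w'; split; first by have [] := LD _ _ _ w'.
- move=> k; have [] := L_lb _ _ _ k w'; have := zK y' z' k.
  set W := (sigma * rho)^-1 * _.
  rewrite -(ler_pdivlMl _ _ cA0) -(ler_pdivlMl _ _ cB0) => hz hx hy hW.
  have e0 := sqr_ge0 `|r k|.
  have := ler_wpM2l (ltW K0) (lerD hW hy).
  have := mulr_ge0 (ltW cAi) e0; have := mulr_ge0 (ltW cBi) e0.
  have := mulr_ge0 (ltW K0) e0.
  have := mulr_ge0 (mulr_ge0 (ltW K0) (ltW cBi)) e0.
  by move: (L x' y' z' k) hx hy hW => l; lra.
- move=> k; rewrite /L; have := phiC x' y' z' k.
  have d0 : 0 <= dist2 x' y' z' k by rewrite !addr_ge0 ?sqr_ge0.
  have := mulr_ge0 (ltW smu0) d0; have := mulr_ge0 (ltW Cp0) (sqr_ge0 `|r k|).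
  by move: (phi x' y' z' k) (dist2 x' y' z' k) => F d; lra.
Qed.

(** The operators on [x] in the potential and in the decrement are only assumed semidefinite. The
    image under [As] is recovered from the residual, and adding its square restores definiteness. *)
Lemma definite_majorization_cvg (lam : R) (xb : X) (yb : Y) (zb : Z) :
  2^-1 < lam <= 1 -> kkt p q df dg A As B Bs c (xb, yb, zb) ->
  psd (2^-1 \*: Sgh \+ T) -> psd (Sfh \+ S) ->
  psd (2^-1 \*: Sf \+ S
       \+ (2^-1 * sigma * (1 - lam) * (2 - rho)) \*: (A \o As)) ->
  pd (2^-1 \*: Sg \+ T
      \+ (sigma * (lam * (2 - rho) ^+ 2 / rho)) \*: (B \o Bs)) ->
  pd (2^-1 \*: Sf \+ S \+ (sigma * (2 - rho)) \*: (A \o As)) ->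
  pd (2^-1 \*: Sg \+ T \+ (sigma * (2 - rho)) \*: (B \o Bs)) ->
  exists x' y' z', [/\ kkt p q df dg A As B Bs c (x', y', z'),
    x @ \oo --> x', y @ \oo --> y' & z @ \oo --> z'].
Proof.
move=> lam01 wb Tpsd [_ H0] [_ M0] N_pd PA_pd PB_pd.
have [lam2 lam1] := andP lam01.
have lam0 : 0 < lam <= 1 by rewrite lam1 andbT; lra.
have lam_gt0 : 0 < lam by case/andP: lam0.
have [cN cN0 yN] := pd_coercive N_pd.
have [cA cA0 xA] := pd_coercive PA_pd.
have [cB cB0 yB] := pd_coercive PB_pd.
have rho2 : 0 < 2 - rho by rewrite subr_gt0.
pose c1 := sigma * (1 - lam) * (2 - rho).
pose c2 := sigma * (2 * lam - 1) * (2 - rho).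
pose c3 := lam * (2 - rho) / rho.
have c1_ge0 : 0 <= c1 by rewrite /c1 mulrAC mulr_ge0 ?subr_ge0// ltW.
have c2_gt0 : 0 < c2 by rewrite /c2 mulrAC mulr_gt0//; lra.
have c3_ge0 : 0 <= c3 by rewrite /c3 divr_ge0 ?mulr_ge0// ltW.
have zeta_ge0 v : 0 <= sqnorm (Sgh \+ T) v.
  have := Tpsd.2 v; have := Sgh_psd.2 v; rewrite -!/(sqnorm _ _) !sqnormE; lra.
(* At [k = 0] the predecessor is again 0 and the last term vanishes. *)
pose L x' y' z' k := phi x' y' z' k + c1 * `|r k| ^+ 2
  + c3 * sqnorm (Sgh \+ T) (y k - y k.-1).
have L_lb x' y' z' k :
    [/\ 0 <= L x' y' z' k,
        sqnorm (Sfh \+ S) (x k - x') <= L x' y' z' k,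
        cB * `|y k - y'| ^+ 2 <= L x' y' z' k &
        (sigma * rho)^-1
          * `|z k - z' + (sigma * (rho - 1)) *: Bs (y k - y')| ^+ 2
          <= L x' y' z' k].
  have hB : cB * `|y k - y'| ^+ 2 <=
      sqnorm (Sgh \+ T \+ (sigma * (2 - rho)) \*: (B \o Bs)) (y k - y').
    apply: le_trans (yB _) _; rewrite !sqnormE.
    have := minor_le_major g_minor g_major (y k - y').
    by have := Sg_psd.2 (y k - y'); rewrite -/(sqnorm _ _); lra.
  have hB0 := mulr_ge0 (ltW cB0) (sqr_ge0 `|y k - y'|).
  have hW := mulr_ge0 (ltW w_gt0)
    (sqr_ge0 `|z k - z' + (sigma * (rho - 1)) *: Bs (y k - y')|).
  have hr := mulr_ge0 c1_ge0 (sqr_ge0 `|r k|).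
  have hz := mulr_ge0 c3_ge0 (zeta_ge0 (y k - y k.-1)).
  have hx : 0 <= sqnorm (Sfh \+ S) (x k - x') := H0 _.
  by rewrite /L; split; lra.
pose D k := sqnorm (2^-1 \*: Sf \+ S
       \+ (2^-1 * sigma * (1 - lam) * (2 - rho)) \*: (A \o As)) (dx k.+1)
  + sqnorm (2^-1 \*: Sg \+ T
      \+ (sigma * (lam * (2 - rho) ^+ 2 / rho)) \*: (B \o Bs)) (dy k.+1)
  + c2 * `|r k.+2| ^+ 2.
have D_lb k : [/\ 0 <= D k,
    sqnorm (2^-1 \*: Sf \+ S
       \+ (2^-1 * sigma * (1 - lam) * (2 - rho)) \*: (A \o As)) (dx k.+1)
      <= D k,
    cN * `|dy k.+1| ^+ 2 <= D k & c2 * `|r k.+2| ^+ 2 <= D k].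
  have h1 := M0 (dx k.+1); rewrite -/(sqnorm _ _) in h1.
  have h2 := yN (dy k.+1); have h3 := mulr_ge0 (ltW cN0) (sqr_ge0 `|dy k.+1|).
  have h4 := mulr_ge0 (ltW c2_gt0) (sqr_ge0 `|r k.+2|).
  by rewrite /D; split; lra.
have LD x' y' z' : kkt p q df dg A As B Bs c (x', y', z') ->
    cvgn (L x' y' z') /\ D @ \oo --> 0.
  move=> w'.
  (* The descent involves the preceding increment and so starts at index 1: the shifted potential is
     used, with zero perturbation. *)
  have [|k|k|k||Lcvg D0] :=
      @fejer_monotone_cvg _ (fun k => L x' y' z' k.+1) (fun=> 0) D.
  - by move=> k; have [] := L_lb x' y' z' k.+1.
  - by [].
  - by have [] := D_lb k.
  - have := mgadmm_inequality2 w' k Tpsd lam0.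
    by rewrite /L /D /c1 /c2 /c3 /=; lra.
  - by rewrite /series/=; under eq_fun do rewrite big1//; exact: is_cvg_cst.
  split=> //; apply/cvg_ex; exists (limn (fun k => L x' y' z' k.+1)).
  by rewrite -cvg_shiftS.
have [_ D0] := LD _ _ _ wb.
have r0 : (fun k => r k) @ \oo --> 0.
  rewrite -2!cvg_shiftS; apply: (cvg0_of_sqr c2_gt0 _ D0) => k.
  by have [] := D_lb k.
have dy0 : (fun k => dy k) @ \oo --> 0.
  rewrite -cvg_shiftS; apply: (cvg0_of_sqr cN0 _ D0) => k.
  by have [] := D_lb k.
have Adx0 : (fun k => As (dx k)) @ \oo --> 0.
  have -> : (fun k => As (dx k)) = (fun k => r k.+1 - r k - Bs (dy k)).
    by apply/funext => k; rewrite !linearB; apply: inner_ext => w;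
      rewrite !innerE; ring.
  rewrite -[0]subr0; apply: cvgB; last exact: cvg_linear0.
  by rewrite -[0]subr0; apply: cvgB => //; rewrite (cvg_shiftS (fun k => r k)).
have dx0 : (fun k => dx k) @ \oo --> 0.
  have D'0 :
      (fun k => D k + sigma * (2 - rho) * `|As (dx k.+1)| ^+ 2) @ \oo --> 0.
    rewrite -[0]addr0; apply: cvgD => //; rewrite -(mulr0 (sigma * (2 - rho))).
    apply: cvgMl_tmp; apply: cvg_sqr0.
    by rewrite (cvg_shiftS (fun k => As (dx k))).
  rewrite -cvg_shiftS; apply: (cvg0_of_sqr cA0 _ D'0) => k.
  apply: le_trans (xA _) _; have [_ + _ _] := D_lb k.
  have := mulr_ge0 (ltW s2_gt0) (sqr_ge0 `|As (dx k.+1)|).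
  have := mulr_ge0 c1_ge0 (sqr_ge0 `|As (dx k.+1)|).
  by rewrite /c1 !sqnormE !(sqnorm_adj _ A_adj); move: (D k) => d; lra.
(* The increment of [y] enters [e] because the last term of [L] is bounded by it. *)
have e0 : (fun k => `|r k| ^+ 2 + `|y k - y k.-1| ^+ 2) @ \oo --> 0.
  rewrite -[0]addr0; apply: cvgD; first exact: cvg_sqr0.
  by apply: cvg_sqr0; rewrite -cvg_shiftS.
have [K K0 zK] := dist_z_le; have [Cp Cp0 phiC] := phi_le_dist2.
have [KB KB0 BK] := linear_sqr_bound Bs.
have [Ct Ct0 zetaC] := sqnorm_bound (Sgh \+ T : {linear Y -> Y}).
have cAi : 0 < cA^-1 by rewrite invr_gt0.
have cBi : 0 < cB^-1 by rewrite invr_gt0.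
pose s2 := sigma * (2 - rho).
apply: (mgadmm_cvg_kkt (L := L)
  (e := fun k => `|r k| ^+ 2 + `|y k - y k.-1| ^+ 2)
  (C := cA^-1 * (1 + 2 * s2 + 2 * s2 * KB * cB^-1) + cB^-1 + K * (1 + cB^-1))
  (C' := Cp + c1 + c3 * Ct) dx0 dy0 r0 _ e0 wb).
  rewrite addr_gt0//; last by rewrite mulr_gt0// addr_gt0.
  by rewrite addr_gt0// mulr_gt0// !addr_gt0// !mulr_gt0.
move=> x' y' z' w'; split; first by have [] := LD _ _ _ w'.
- move=> k; have [L0 hx hy hW] := L_lb x' y' z' k; have hz := zK y' z' k.
  move: hz hW; set W := (sigma * rho)^-1 * _; clearbody W => hz hW.
  rewrite -(ler_pdivlMl _ _ cB0) in hy.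
  (* The [x] error reaches the potential through feasibility; the resulting coefficient is the first
     factor in [C]. *)
  have hAx : `|As (x k - x')| ^+ 2 <=
      2 * `|r k| ^+ 2 + 2 * (KB * (cB^-1 * L x' y' z' k)).
    have -> : As (x k - x') = r k - Bs (y k - y').
      have [_ _ <-] := kkt_subgradients w'.
      by rewrite !linearB; apply: inner_ext => w; rewrite !innerE; ring.
    apply: le_trans (normD_sqr_le _ _) _; rewrite normrN lerD2l ler_pM2l//.
    by apply: le_trans (BK _) _; rewrite ler_pM2l.
  have hAx' : cA * `|x k - x'| ^+ 2 <= L x' y' z' k
      + s2 * (2 * `|r k| ^+ 2 + 2 * (KB * (cB^-1 * L x' y' z' k))).
    apply: le_trans (xA _) _.
    have := ler_wpM2l (ltW s2_gt0) hAx; rewrite -/s2.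
    have := minor_le_major f_minor f_major (x k - x').
    have := Sf_psd.2 (x k - x'); rewrite -/(sqnorm _ _).
    by move: hx; rewrite !sqnormE !(sqnorm_adj _ A_adj) -/s2; lra.
  rewrite -(ler_pdivlMl _ _ cA0) in hAx'.
  have := ler_wpM2l (ltW K0) (lerD hW hy).
  have s2_ge0 : 0 <= s2 := ltW s2_gt0.
  have re0 := sqr_ge0 `|r k|; have ye0 := sqr_ge0 `|y k - y k.-1|.
  have cAe v : 0 <= v -> 0 <= cA^-1 * v by move=> ?; rewrite mulr_ge0// ltW.
  have KBe v : 0 <= v -> 0 <= KB * cB^-1 * v.
    by move=> ?; rewrite !mulr_ge0// ltW.
  have s2e v : 0 <= v -> 0 <= s2 * v by move=> ?; rewrite mulr_ge0.
  have cBe v : 0 <= v -> 0 <= cB^-1 * v by move=> ?; rewrite mulr_ge0// ltW.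
  have Ke v : 0 <= v -> 0 <= K * v by move=> ?; rewrite mulr_ge0// ltW.
  have ee0 := addr_ge0 re0 ye0.
  have := cAe _ ee0; have := cAe _ (s2e _ (KBe _ ee0)).
  have := cAe _ (s2e _ ye0); have := cAe _ (s2e _ L0); have := cBe _ ee0.
  have := Ke _ ee0; have := Ke _ (cBe _ ee0).
  by move: (L x' y' z' k) hAx' hy hW hz => l; lra.
- move=> k; rewrite /L; have := phiC x' y' z' k.
  have d0 : 0 <= dist2 x' y' z' k by rewrite !addr_ge0 ?sqr_ge0.
  have re0 := sqr_ge0 `|r k|; have ye0 := sqr_ge0 `|y k - y k.-1|.
  have := ler_wpM2l c3_ge0 (zetaC (y k - y k.-1)).
  have := mulr_ge0 (ltW Cp0) (addr_ge0 re0 ye0).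
  have := mulr_ge0 c1_ge0 (addr_ge0 d0 ye0).
  have := mulr_ge0 (mulr_ge0 c3_ge0 (ltW Ct0)) (addr_ge0 d0 re0).
  move: (phi x' y' z' k) (dist2 x' y' z' k) (sqnorm _ _) => F d s.
  lra.
Qed.

End mgadmm_theory.

(** * Functions of one block of a product space *)

Section eprod_coordinates.
Context (R : realType) (n : nat) (E : 'I_n -> euclidType R).

(** A named projection can carry a linear structure, and continuity then follows from finite
    dimension. *)
Definition eprod_coord i (u : eprod E) : E i := u i.

Lemma eprod_coord_linear i : linear (eprod_coord i).
Proof. by move=> a u v; rewrite /eprod_coord eprodD eprodZ. Qed.

HB.instance Definition _ i :=
  GRing.isLinear.Build R (eprod E) (E i) *:%R (eprod_coord i)
    (eprod_coord_linear i).

Lemma lsc_eprod_coord i (h : E i -> \bar R) : lower_semicontinuous h ->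
  lower_semicontinuous (fun u : eprod E => h (u i)).
Proof.
move=> hlsc u a /hlsc[U Uu aU]; exists ((eprod_coord i) @^-1` U) => [|v /aU//].
exact: (@linear_continuousE _ _ _ (eprod_coord i)).
Qed.

Lemma convex_eprod_coord i (h : E i -> \bar R) : convex_efun h ->
  convex_efun (fun u : eprod E => h (u i)).
Proof. by move=> hconv a u v a01; rewrite eprodD !eprodZ; exact: hconv. Qed.

End eprod_coordinates.

Theorem theorem4p1 (R : realType) (s t : nat)
  (X_ : 'I_s.+1 -> euclidType R) (Y_ : 'I_t.+1 -> euclidType R)
  (Z : euclidType R)
  (p1 : X_ ord0 -> \bar R) (q1 : Y_ ord0 -> \bar R)
  (p : eprod X_ -> \bar R) (q : eprod Y_ -> \bar R)
  (f : eprod X_ -> R) (g : eprod Y_ -> R)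
  (df : eprod X_ -> eprod X_) (dg : eprod Y_ -> eprod Y_)
  (A : {linear Z -> eprod X_}) (As : {linear eprod X_ -> Z})
  (B : {linear Z -> eprod Y_}) (Bs : {linear eprod Y_ -> Z}) (c : Z)
  (p1_cpc : closed_proper_convex p1) (q1_cpc : closed_proper_convex q1)
  (pE : forall u, p u = p1 (u ord0)) (qE : forall v, q v = q1 (v ord0))
  (f_convex : convex_function [set: eprod X_] f)
  (g_convex : convex_function [set: eprod Y_] g)
  (f_grad : is_gradient f df) (g_grad : is_gradient g dg)
  (df_lip : lipschitz df) (dg_lip : lipschitz dg)
  (A_adj : adjoint A As) (B_adj : adjoint B Bs)
  (cq : exists2 w, relint (edom p `*` edom q) w & As w.1 + Bs w.2 = c)
  (Sf Sfh : {linear eprod X_ -> eprod X_})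
  (Sg Sgh : {linear eprod Y_ -> eprod Y_})
  (Sf_psd : psd Sf) (Sfh_psd : psd Sfh) (Sg_psd : psd Sg) (Sgh_psd : psd Sgh)
  (f_minor : forall u u', f u' + inner (u - u') (df u')
                          + 2^-1 * sqnorm Sf (u - u') <= f u)
  (f_major : forall u u', f u <= f u' + inner (u - u') (df u')
                          + 2^-1 * sqnorm Sfh (u - u'))
  (g_minor : forall v v', g v' + inner (v - v') (dg v')
                          + 2^-1 * sqnorm Sg (v - v') <= g v)
  (g_major : forall v v', g v <= g v' + inner (v - v') (dg v')
                          + 2^-1 * sqnorm Sgh (v - v'))
  (rho sigma : R) (rho_gt0 : 0 < rho) (rho_lt2 : rho < 2) (sigma_gt0 : 0 < sigma)
  (S : {linear eprod X_ -> eprod X_}) (T : {linear eprod Y_ -> eprod Y_})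
  (S_sa : selfadjoint S) (T_sa : selfadjoint T)
  (P_pd : pd (Sfh \+ S \+ sigma \*: (A \o As)))
  (Q_pd : pd (Sgh \+ T \+ sigma \*: (B \o Bs)))
  (x : nat -> eprod X_) (y : nat -> eprod Y_) (z : nat -> Z)
  (xyz : mgadmm p q df dg A As B Bs c rho sigma
           (Sfh \+ S \+ sigma \*: (A \o As))
           (Sgh \+ T \+ sigma \*: (B \o Bs)) x y z)
  (xb : eprod X_) (yb : eprod Y_) (zb : Z)
  (wb_kkt : kkt p q df dg A As B Bs c (xb, yb, zb)) :
  let AAs := A \o As in
  let BBs := B \o Bs in
  let r k := As (x k) + Bs (y k) - c in
  let dz k := z k.+1 - z k + (sigma * (rho - 1)) *: Bs (y k.+1 - y k) in
  let phi k :=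
    (sigma * rho)^-1 * `|z k - zb + (sigma * (rho - 1)) *: Bs (y k - yb)| ^+ 2
    + sqnorm (Sfh \+ S) (x k - xb)
    + sqnorm (Sgh \+ T \+ (sigma * (2 - rho)) \*: BBs) (y k - yb) in
  let Mf lam := 2^-1 \*: Sf \+ S
                \+ (2^-1 * sigma * (1 - lam) * (2 - rho)) \*: AAs in
  let Ng lam := 2^-1 \*: Sg \+ T
                \+ (sigma * (lam * (2 - rho) ^+ 2 / rho)) \*: BBs in
  let theta lam k := sqnorm (Mf lam) (x k - x k.-1)
                     + sqnorm (Ng lam) (y k - y k.-1) in
  let zeta k := sqnorm (Sgh \+ T) (y k - y k.-1) in
  let converges_to_solutions :=
    (exists2 w, primal_solutions p q f g As Bs c w
              & (fun k => (x k, y k)) @ \oo --> w) /\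
    (exists2 w, dual_solutions p q f g A B c w & z @ \oo --> w) in
  ((forall beta : R, 0 < beta < 2^-1 ->
      let mu := beta * (1 - beta) / (1 - 2 * beta) in
      forall k,
        (sigma * rho ^+ 2)^-1 * `|dz k| ^+ 2
        + sqnorm (Sfh \+ S \+ (sigma * beta * (2 - rho)) \*: AAs) (x k.+1 - x k)
        + sqnorm (Sgh \+ T \+ (sigma * beta * (2 - rho)) \*: BBs) (y k.+1 - y k)
        - ((1 + 2 * mu - mu * rho) / (sigma * rho ^+ 2) * `|dz k| ^+ 2
           + sqnorm (Sfh \- 2^-1 \*: Sf) (x k.+1 - x k)
           + sqnorm (Sgh \- 2^-1 \*: Sg \+ (sigma * beta * (2 - rho)) \*: BBs)
               (y k.+1 - y k))
        <= (phi k + sigma * mu * (2 - rho) * `|r k| ^+ 2)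
           - (phi k.+1 + sigma * mu * (2 - rho) * `|r k.+1| ^+ 2)) /\
   (forall beta : R, 0 < beta < 2^-1 ->
      pd (Sfh \+ S \+ (sigma * beta * (2 - rho)) \*: AAs) ->
      pd (Sgh \+ T \+ (sigma * beta * (2 - rho)) \*: BBs) ->
      (\sum_(0 <= k <oo)
         (sqnorm Sfh (x k.+1 - x k)
          + sqnorm (Sgh \+ (sigma * (2 - rho)) \*: BBs) (y k.+1 - y k)
          + `|r k.+1| ^+ 2)%:E < +oo)%E ->
      converges_to_solutions)) /\
  (psd (2^-1 \*: Sgh \+ T) ->
   (forall lam : R, 0 < lam <= 1 ->
      forall k, (1 <= k)%N ->
        theta lam k.+1 + sigma * (2 * lam - 1) * (2 - rho) * `|r k.+1| ^+ 2
        <= (phi k + sigma * (1 - lam) * (2 - rho) * `|r k| ^+ 2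
            + lam * (2 - rho) / rho * zeta k)
           - (phi k.+1 + sigma * (1 - lam) * (2 - rho) * `|r k.+1| ^+ 2
              + lam * (2 - rho) / rho * zeta k.+1)) /\
   (forall lam : R, 2^-1 < lam <= 1 ->
      psd (Sfh \+ S) -> psd (Mf lam) -> pd (Ng lam) ->
      pd (2^-1 \*: Sf \+ S \+ (sigma * (2 - rho)) \*: AAs) ->
      pd (2^-1 \*: Sg \+ T \+ (sigma * (2 - rho)) \*: BBs) ->
      converges_to_solutions)).
Proof.
move=> AAs BBs r dz phi Mf Ng theta zeta converges_to_solutions.
have [_ [_ p1_gt] _] := p1_cpc; have [_ [_ q1_gt] _] := q1_cpc.
(* The starting iterate witnesses that the domain is nonempty. *)
have p_proper : Defs.proper p.
  by case: xyz => px _ _; split; [exists (x 0)|move=> u; rewrite pE].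
have q_proper : Defs.proper q.
  by case: xyz => _ qy _; split; [exists (y 0)|move=> u; rewrite qE].
have pfun : p = fun u => p1 (u ord0) by exact/funext.
have qfun : q = fun u => q1 (u ord0) by exact/funext.
have [p_lsc p_conv] : lower_semicontinuous p /\ convex_efun p.
  rewrite pfun; case: p1_cpc => lsc _ conv.
  by split; [exact: lsc_eprod_coord|exact: convex_eprod_coord].
have [q_lsc q_conv] : lower_semicontinuous q /\ convex_efun q.
  rewrite qfun; case: q1_cpc => lsc _ conv.
  by split; [exact: lsc_eprod_coord|exact: convex_eprod_coord].
have df_cont := lipschitz_continuous df_lip.
have dg_cont := lipschitz_continuous dg_lip.
have conclude : (exists x' y' z',
    [/\ kkt p q df dg A As B Bs c (x', y', z'),
      x @ \oo --> x', y @ \oo --> y' & z @ \oo --> z']) ->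
    converges_to_solutions.
  move=> [x' [y' [z' [w' xx' yy' zz']]]].
  have f_sub := subgradient_of_minor Sf_psd f_minor.
  have g_sub := subgradient_of_minor Sg_psd g_minor.
  split; [exists (x', y') | exists z'] => //.
  - exact: kkt_primal_solution w'.
  - exact: (cvg_pair xx' yy').
  - exact: kkt_dual_solution w'.
have P_sa := P_pd.1; have Q_sa := Q_pd.1.
split; [split|move=> Tpsd; split].
- move=> beta beta01 mu k.
  exact: (mgadmm_inequality1
    p_proper q_proper p_conv q_conv A_adj B_adj Sf_psd Sfh_psd Sg_psd
    Sgh_psd f_minor f_major g_minor g_major rho_gt0 rho_lt2 sigma_gt0
    S_sa T_sa P_sa Q_sa xyz wb_kkt k
    beta01 erefl).
- move=> beta beta01 PA_pd PB_pd asum; apply: conclude.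
  exact: (summable_increments_cvg
    p_proper q_proper p_conv q_conv A_adj B_adj Sf_psd Sfh_psd Sg_psd
    Sgh_psd f_minor f_major g_minor g_major rho_gt0 rho_lt2 sigma_gt0
    S_sa T_sa P_sa Q_sa xyz p_lsc q_lsc df_cont dg_cont
    beta01 wb_kkt PA_pd PB_pd asum).
- move=> lam lam01 [//|k] _.
  exact: (mgadmm_inequality2
    p_proper q_proper p_conv q_conv A_adj B_adj Sf_psd Sfh_psd Sg_psd
    Sgh_psd f_minor f_major g_minor g_major rho_gt0 rho_lt2 sigma_gt0
    S_sa T_sa P_sa Q_sa xyz wb_kkt k
    Tpsd lam01).
- move=> lam lam01 H0 M0 N_pd PA_pd PB_pd; apply: conclude.
  exact: (definite_majorization_cvg
    p_proper q_proper p_conv q_conv A_adj B_adj Sf_psd Sfh_psd Sg_psd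
    Sgh_psd f_minor f_major g_minor g_major rho_gt0 rho_lt2 sigma_gt0
    S_sa T_sa P_sa Q_sa xyz p_lsc q_lsc df_cont dg_cont
    lam01 wb_kkt Tpsd H0 M0 N_pd PA_pd PB_pd).
Qed.
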